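(* Let $k>d$, let $\mathbf{W}^*\in\mathbb{R}^{k\times d}$ with $\sigma_{\min}(\mathbf{W}^* )>0$, and let $\mathbf{v}^*\in\mathbb{R}^k$ have nonnegative entries. Let $\mathbf{x}_1,\dots,\mathbf{x}_n$ be i.i.d. $\mathcal{N}(\mathbf{0},\mathbf{I}_d)$ and $y_i=\langle \mathbf{v}^*,\phi(\mathbf{W}^*\mathbf{x}_i)\rangle$ with $\phi(z)=z^2$ applied entrywise. Fix $\nu>0$, set $\mathbf{v}=\nu\mathbf{1}\in\mathbb{R}^k$, and let $\mathcal{L}(\mathbf{W})=\frac{1}{2n}\sum_{i=1}^n(y_i-\mathbf{v}^T\phi(\mathbf{W}\mathbf{x}_i))^2$. There are numerical constants $c,C,\gamma>0$ such that if $c\,d\log d\le n\le C d^2$, then with probability at least $1-12de^{-\gamma d}-8/d$ the following holds: for all $\epsilon_g,\epsilon_H\ge 0$, every $\mathbf{W}\in\mathbb{R}^{k\times d}$ satisfying $$\|\nabla\mathcal{L}(\mathbf{W})\|_F\le\epsilon_g\quad\text{and}\quad \nabla^2\mathcal{L}(\mathbf{W})\succeq-\epsilon_H\mathbf{I}$$ obeys $$\mathcal{L}(\mathbf{W})\le\frac{\epsilon_g}{\sqrt{\nu}}\max\Big(\sqrt{1+14\|{\mathbf{W}^*}^T\mathbf{D}_{\mathbf{v}^*}\mathbf{W}^*\|_*},\,4\frac{\epsilon_g}{\sqrt{\nu}}\Big)+\frac{\epsilon_H}{2\nu}\|{\mathbf{W}^*}^T\mathbf{D}_{\mathbf{v}^*}\mathbf{W}^*\|_*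 .$$
   Context: $\mathbf{D}_{\mathbf{v}^*}=\mathrm{diag}(\mathbf{v}^* )$; $\|\cdot\|_*$ is the nuclear norm (sum of singular values); $\|\cdot\|_F$ the Frobenius norm; $\nabla\mathcal{L}$ and $\nabla^2\mathcal{L}$ are the gradient and Hessian with respect to $\mathrm{vect}(\mathbf{W})$; $\mathbf{1}$ is the all-ones vector. *)

(* Defs.v *)
From HB Require Import structures.
From mathcomp Require Import all_boot all_order all_algebra.
From mathcomp Require Import all_classical all_reals all_analysis.
Set Implicit Arguments. Unset Strict Implicit. Unset Printing Implicit Defensive.
Import Order.TTheory GRing.Theory Num.Theory.
Import numFieldNormedType.Exports.
Local Open Scope classical_set_scope.
Local Open Scope ring_scope.

Section Defs.
Context {R : realType}.

(* Eigenvalues (with multiplicity) of a square matrix whose characteristic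
   polynomial splits over R (e.g. symmetric matrices); [::] otherwise. *)
Definition eigvals {m : nat} (A : 'M[R]_m) : seq R :=
  match pselect (exists s : seq R, char_poly A = \prod_(x <- s) ('X - x%:P)) with
  | left H => projT1 (cid H)
  | right _ => [::]
  end.

(* Singular values of M : 'M_(p, q): square roots of the eigenvalues of M^T M
   (q values; for p >= q these are exactly the min(p,q) singular values,
   otherwise padded with zeros). *)
Definition sing_vals {p q : nat} (M : 'M[R]_(p, q)) : seq R :=
  map Num.sqrt (eigvals (M^T *m M)).

Definition sigma_min {p q : nat} (M : 'M[R]_(p, q)) : R :=
  let s := sing_vals M in foldr Num.min (head 0 s) s.

Definition nuclear_norm {p q : nat} (M : 'M[R]_(p, q)) : R :=
  \sum_(x <- sing_vals M) x.

Definition frob {p q : nat} (M : 'M[R]_(p, q)) : R :=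
  Num.sqrt (\sum_i \sum_j M i j ^+ 2).

Definition unit_dir {k d : nat} (p : 'I_(k * d)) : 'M[R]_(k, d) :=
  vec_mx (delta_mx 0 p).

Definition grad {k d : nat} (f : 'M[R]_(k, d) -> R) (W : 'M[R]_(k, d))
  : 'rV[R]_(k * d) :=
  \row_p ('D_(unit_dir p) f W).

Definition hess {k d : nat} (f : 'M[R]_(k, d) -> R) (W : 'M[R]_(k, d))
  : 'M[R]_(k * d) :=
  \matrix_(p, q) ('D_(unit_dir p) (fun W' => 'D_(unit_dir q) f W') W).

Definition psd_ge {m : nat} (A B : 'M[R]_m) : Prop :=
  forall u : 'rV[R]_m, 0 <= (u *m (A - B) *m u^T) 0 0.

Definition sq_act {k : nat} (z : 'cV[R]_k) : 'cV[R]_k := map_mx (fun t => t ^+ 2) z.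

Definition net {k d : nat} (v : 'rV[R]_k) (W : 'M[R]_(k, d)) (x : 'cV[R]_d) : R :=
  (v *m sq_act (W *m x)) 0 0.

Definition emp_loss {n k d : nat} (xs : 'I_n -> 'cV[R]_d) (ys : 'I_n -> R)
  (v : 'rV[R]_k) (W : 'M[R]_(k, d)) : R :=
  (n%:R *+ 2)^-1 * \sum_(i < n) (ys i - net v W (xs i)) ^+ 2.

End Defs.

(* Mutual independence of a finite family of real random variables:
   product rule for all measurable sets (taking B i = setT covers subfamilies). *)
Definition mutually_independent {dT : measure_display} {T : measurableType dT}
  {R : realType} {I : finType} (P : probability T R) (X : I -> T -> R) : Prop :=
  forall B : I -> set R, (forall i, measurable (B i)) ->
    P (\bigcap_(i in [set: I]) (X i @^-1` B i)) =
    (\prod_(i : I) P (X i @^-1` B i))%E.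

(* Main.v *)
Require Import Defs.
From HB Require Import structures.
From mathcomp Require Import all_boot all_order all_algebra.
From mathcomp Require Import all_classical all_reals all_analysis.
From mathcomp Require Import measurable_realfun ring lra.
From mathcomp Require spectral complex.
Set Implicit Arguments.
Unset Strict Implicit.
Unset Printing Implicit Defensive.
Import Order.TTheory GRing.Theory Num.Theory.
Import numFieldNormedType.Exports.
Local Open Scope classical_set_scope.
Local Open Scope ring_scope.

(* Write q_i = nu |W x_i|^2 and rho_i = y_i - q_i. Since k > d there is a nonzero
   vector a with a^T W = 0; in the direction a b^T the Gauss-Newton part of the
   Hessian vanishes, so the second-order condition reads
   - (2 nu / n) sum_i rho_i (b . x_i)^2 >= - eps_H |b|^2 for every b. Summing over
   the rows of W* bounds sum_i rho_i y_i, while sum_i rho_i q_i is a multiple of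
   <grad L(W), W>; as 2 n L(W) = sum_i rho_i y_i - sum_i rho_i q_i this yields
   L(W) <= eps_g |W|_F / 4 + eps_H tr(M) / (4 nu) with M = W*^T D W*, and
   tr(M) is at most the nuclear norm of M.
   If sqrt(nu) |W|_F exceeds four times the maximum in the statement, then
   <grad L(W), W> >= (sum_i q_i^2 - sum_i y_i^2) / n contradicts the bound eps_g
   on the gradient, as soon as
   sum_i (u . x_i)^2 >= n |u|^2 / 8 for all u and sum_i y_i^2 <= 588 n tr(M)^2.
   The first event is obtained from a Chernoff bound and a union bound over a grid
   of mesh 1 / (8 d^2), whose cardinality exp(O(d log d)) is affordable because
   n >= c d log d; the second one from Chebyshev's inequality. Each failure
   probability is at most 1 / d, so that C and gamma may be arbitrary. *)

(** * Trace and nuclear norm *)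

Section Similar.
Context {F : fieldType} {n : nat}.

(** Conjugation fixes the scalar matrix X I, so it conjugates the whole characteristic matrix, and
    the determinants of [Q] and its inverse cancel. *)
Lemma char_poly_conj (Q A : 'M[F]_n) :
  Q \in unitmx -> char_poly (invmx Q *m A *m Q) = char_poly A.
Proof.
move=> Qu; rewrite /char_poly.
set f := @polyC F.
have -> : char_poly_mx (invmx Q *m A *m Q) =
    map_mx f (invmx Q) *m char_poly_mx A *m map_mx f Q.
  rewrite /char_poly_mx !map_mxM /= mulmxBr mulmxBl; congr (_ - _).
  by rewrite scalar_mxC -mulmxA -map_mxM mulVmx// map_mx1 mulmx1.
rewrite !det_mulmx mulrAC -det_mulmx -map_mxM mulVmx// map_mx1 det1 mul1r //.
Qed.

End Similar.

Section TraceNuclear.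
Context {R : realType}.
Import complex.

(** Over the complex numbers [M] is Hermitian, hence diagonalizable with real eigenvalues; the
    factorizations descend because R[X] embeds injectively in C[X]. The second one serves the
    singular values, which come from M^T M = M M. *)
Lemma symmetric_spectral (m : nat) (M : 'M[R]_m) : M^T = M ->
  exists r : 'rV[R]_m,
    char_poly M = \prod_(i < m) ('X - (r 0 i)%:P) /\
    char_poly (M *m M) = \prod_(i < m) ('X - (r 0 i ^+ 2)%:P).
Proof.
move=> Msym.
set C := (R[i])%C.
set g : {rmorphism R -> C} := real_complex R.
pose MC := map_mx g M.
have MCh : MC \is hermsymmx.
  apply: spectral.realsym_hermsym.
    by apply/is_hermitianmxP; rewrite expr0 scale1r map_mx_id // /MC map_trmx Msym.
  apply/mxOverP => i j; rewrite mxE; by rewrite /g /= complex_real.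
have /spectral.orthomx_spectralP := spectral.hermitian_normalmx MCh.
set Q := spectral.spectralmx MC; set s := spectral.spectral_diag MC => MCE.
have Qu : Q \in unitmx := spectral.spectral_unit MC.
have sreal : forall i, s 0 i = g (Re (s 0 i)).
  move=> i; have /mxOverP /(_ 0 i) := spectral.hermitian_spectral_diag_real MCh.
  by move=> /RRe_real.
have diagE (t : 'rV[C]_m) : char_poly (diag_mx t) = \prod_(i < m) ('X - (t 0 i)%:P).
  rewrite char_poly_trig; last first.
    by apply/is_trig_mxP => i j ij; rewrite mxE; case: eqP ij => // ->; rewrite ltnn.
  by apply: eq_bigr => i _; rewrite mxE eqxx.
have ginj : injective (map_poly g) by apply: map_inj_poly; [exact: complexI|exact: rmorph0].
have gprod (t : 'I_m -> R) : map_poly g (\prod_(i < m) ('X - (t i)%:P)) =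
    \prod_(i < m) ('X - (g (t i))%:P).
  rewrite rmorph_prod; apply: eq_bigr => i _.
  by rewrite rmorphB /= map_polyX map_polyC.
exists (\row_i Re (s 0 i)); split; apply: ginj; rewrite map_char_poly gprod.
  rewrite -/MC MCE char_poly_conj // diagE; apply: eq_bigr => i _.
  by rewrite mxE -sreal.
rewrite map_mxM -/MC.
have -> : MC *m MC = invmx Q *m (diag_mx s *m diag_mx s) *m Q.
  by rewrite {1 2}MCE !mulmxA mulmxK.
rewrite char_poly_conj // mulmx_diag diagE; apply: eq_bigr => i _.
by rewrite !mxE rmorphXn /= -sreal expr2.
Qed.

(** Compares the subleading coefficients, which are minus the trace and minus the sum of the roots;
    size 0 has no such coefficient and is treated apart. *)
Lemma char_poly_split_trace (m : nat) (M : 'M[R]_m) (r : 'I_m -> R) :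
  char_poly M = \prod_(i < m) ('X - (r i)%:P) -> \tr M = \sum_i r i.
Proof.
move=> h; case: m M r h => [|m] M r h.
  by rewrite big_ord0 /mxtrace big_ord0.
apply: oppr_inj; rewrite -char_poly_trace // h.
rewrite (_ : \prod_(i < m.+1) _ = \prod_(x <- codom r) ('X - x%:P)); last first.
  by rewrite big_map big_enum.
have := @coefPn_prod_XsubC R (codom r).
rewrite size_codom card_ord => /(_ isT) ->; congr (- _).
by rewrite big_map big_enum.
Qed.

(** The singular values of a symmetric matrix are the absolute values of its eigenvalues. *)
Lemma trace_le_nuclear_norm (m : nat) (M : 'M[R]_m) :
  M^T = M -> \tr M <= nuclear_norm M.
Proof.
move=> Msym; have [r [rM rMM]] := symmetric_spectral Msym.
rewrite (char_poly_split_trace rM) /nuclear_norm /sing_vals Msym /eigvals.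
have mm : \prod_(i < m) ('X - (r 0 i ^+ 2)%:P) =
    \prod_(x <- codom (fun i => r 0 i ^+ 2)) ('X - x%:P).
  by rewrite big_map big_enum.
case: pselect => [h|[]]; last by eexists; rewrite rMM mm.
(* [eigvals] chooses some list of roots; unique factorization identifies it with the squares r_i^2
   up to order, which the sum ignores. *)
case: (cid h) => s /=; rewrite rMM mm => /prod_XsubC_eq sE.
rewrite big_map -(perm_big _ sE) big_map big_enum /=.
by apply: ler_sum => i _; rewrite sqrtr_sqr ler_norm.
Qed.

End TraceNuclear.

(** * Derivatives of the empirical loss *)

Section Calculus.
Context {R : realType}.

(** The difference quotient in direction [v] is exactly [p.[h]], so its limit is the value of a
    continuous function at 0. This fits the loss, which is polynomial along every line. *)
Lemma derive_along_poly (V : normedModType R) (f : V -> R) (a v : V)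
    (p : {poly R}) :
  (forall h : R, f (h *: v + a) = f a + h * p.[h]) -> 'D_v f a = p.[0].
Proof.
move=> fE; apply: cvg_lim => //.
apply: (@cvg_trans _ (p.[h] @[h --> 0^'])).
  apply: near_eq_cvg; near=> h.
  have h0 : h != 0 by near: h; exact: nbhs_dnbhs_neq.
  by rewrite /= fE addrAC subrr add0r /GRing.scale /= mulKf.
apply: cvg_within_filter; exact: continuous_horner.
Unshelve. all: by end_near. Qed.

End Calculus.

(** * Inner products and Cauchy-Schwarz *)

Section Dot.
Context {R : realType}.

Definition dotv {m : nat} (a b : 'cV[R]_m) : R := \sum_i a i 0 * b i 0.

Lemma dotvC m (a b : 'cV[R]_m) : dotv a b = dotv b a.
Proof. by apply: eq_bigr => i _; rewrite mulrC. Qed.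

Lemma dotv_linl m (c : R) (a b z : 'cV[R]_m) :
  dotv (c *: a + b) z = c * dotv a z + dotv b z.
Proof.
rewrite /dotv mulr_sumr -big_split /=; apply: eq_bigr => i _.
by rewrite !mxE mulrDl mulrA.
Qed.

Lemma dotv_linr m (c : R) (a b z : 'cV[R]_m) :
  dotv z (c *: a + b) = c * dotv z a + dotv z b.
Proof. by rewrite dotvC dotv_linl !(dotvC z). Qed.

Lemma dotvZl m (c : R) (a z : 'cV[R]_m) : dotv (c *: a) z = c * dotv a z.
Proof. by rewrite /dotv mulr_sumr; apply: eq_bigr => i _; rewrite mxE mulrA. Qed.

Lemma dotv_ge0 m (a : 'cV[R]_m) : 0 <= dotv a a.
Proof. by apply: sumr_ge0 => i _; rewrite -expr2 sqr_ge0. Qed.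

End Dot.

Section CauchySchwarz.
Context {R : realType}.

(** The sum of (A g - B f)^2 equals A (A C - B^2); if A = 0, every [f i] vanishes and so does B. *)
Lemma sum_CauchySchwarz (I : finType) (f g : I -> R) :
  (\sum_i f i * g i) ^+ 2 <= (\sum_i f i ^+ 2) * (\sum_i g i ^+ 2).
Proof.
set A := \sum_i f i ^+ 2; set B := \sum_i _ * _; set C := \sum_i g i ^+ 2.
have A0 : 0 <= A by apply: sumr_ge0 => i _; exact: sqr_ge0.
have := @sumr_ge0 R I (enum I) xpredT (fun i => (A * g i - B * f i) ^+ 2).
move/(_ (fun i _ => sqr_ge0 _)); rewrite big_enum /=.
have -> : \sum_i (A * g i - B * f i) ^+ 2 = A * (A * C - B ^+ 2).
  transitivity (\sum_i (A ^+ 2 * g i ^+ 2 + (- 2 * A * B) * (f i * g i) + B ^+ 2 * f i ^+ 2)).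
    by apply: eq_bigr => i _; ring.
  by rewrite !big_split /= -!mulr_sumr -/A -/B -/C; ring.
have [A00|Apos] := eqVneq A 0; last first.
  have Ap : 0 < A by rewrite lt_neqAle eq_sym Apos.
  by rewrite pmulr_rge0 // subr_ge0.
move=> _; suff -> : B = 0 by rewrite A00 mul0r expr0n lexx.
apply: big1 => i _; have /psumr_eq0P H := A00.
suff /eqP : f i ^+ 2 = 0 by rewrite sqrf_eq0 => /eqP ->; rewrite mul0r.
by apply: H => // j _; exact: sqr_ge0.
Qed.

(** Jensen's inequality for the square with unnormalized weights: Cauchy-Schwarz for sqrt(p) and
    sqrt(p) a. *)
Lemma sum_jensen_sqr (I : finType) (p a : I -> R) : (forall i, 0 <= p i) ->
  (\sum_i p i * a i) ^+ 2 <= (\sum_i p i) * (\sum_i p i * a i ^+ 2).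
Proof.
move=> p0.
have := sum_CauchySchwarz (fun i => Num.sqrt (p i)) (fun i => Num.sqrt (p i) * a i).
have e i : Num.sqrt (p i) ^+ 2 = p i by rewrite sqr_sqrtr.
under eq_bigr do rewrite mulrA -expr2 e.
under [X in _ <= X * _]eq_bigr do rewrite e.
by under [X in _ <= _ * X]eq_bigr do rewrite exprMn e.
Qed.

End CauchySchwarz.

(** * Gradient and Hessian of the loss in arbitrary directions *)

Section Loss.
Context {R : realType} (n k d : nat) (xs : 'I_n -> 'cV[R]_d) (ys : 'I_n -> R)
  (nu : R).
Let L := emp_loss xs ys (const_mx nu : 'rV[R]_k).
Let rho (W : 'M[R]_(k, d)) i := ys i - net (const_mx nu) W (xs i).
Let K : R := (n%:R *+ 2)^-1.

Lemma net_const (W : 'M[R]_(k, d)) x :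
  net (const_mx nu) W x = nu * dotv (W *m x) (W *m x).
Proof.
rewrite /net /dotv mxE mulr_sumr; apply: eq_bigr => l _.
by rewrite mxE /sq_act mxE expr2.
Qed.

(** Each residual is quadratic along a line, so the loss is quartic there and its derivatives are
    read off coefficients. *)
Let rho_line (h : R) (U W : 'M[R]_(k, d)) i :
  rho (h *: U + W) i = rho W i - 2%:R * nu * h * dotv (W *m xs i) (U *m xs i)
    - nu * h ^+ 2 * dotv (U *m xs i) (U *m xs i).
Proof.
rewrite /rho !net_const mulmxDl -scalemxAl !dotv_linr !dotv_linl.
rewrite (dotvC (U *m _) (W *m _)); ring.
Qed.

Lemma derive_emp_loss (U W : 'M[R]_(k, d)) :
  'D_U L W = K * \sum_i - (4%:R * nu * rho W i * dotv (W *m xs i) (U *m xs i)).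
Proof.
pose b i := dotv (W *m xs i) (U *m xs i).
pose c i := dotv (U *m xs i) (U *m xs i).
(* [p] is (L(W + h U) - L(W)) / h, expanded in powers of h. *)
pose p : {poly R} := K *: \sum_i ((- (4%:R * nu * rho W i * b i))%:P +
  (4%:R * nu ^+ 2 * b i ^+ 2 - 2%:R * nu * rho W i * c i)%:P * 'X +
  (4%:R * nu ^+ 2 * b i * c i)%:P * 'X^2 + (nu ^+ 2 * c i ^+ 2)%:P * 'X^3).
rewrite (@derive_along_poly R _ L W U p).
  rewrite /p hornerZ horner_sum; congr (_ * _); apply: eq_bigr => i _.
  by rewrite !hornerE /= -/(b i); ring.
move=> h; rewrite /p hornerZ horner_sum /L /emp_loss -/K mulrCA -mulrDr; congr (_ * _).
rewrite mulr_sumr -big_split /=; apply: eq_bigr => i _.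
rewrite -/(rho _ _) -/(rho W i) rho_line -/(b i) -/(c i) !hornerE /=; ring.
Qed.

Lemma derive2_emp_loss (U V W : 'M[R]_(k, d)) :
  'D_U (fun W' => 'D_V L W') W =
  K * \sum_i (8%:R * nu ^+ 2 * dotv (W *m xs i) (U *m xs i) * dotv (W *m xs i) (V *m xs i)
     - 4%:R * nu * rho W i * dotv (U *m xs i) (V *m xs i)).
Proof.
pose b i := dotv (W *m xs i) (U *m xs i).
pose c i := dotv (U *m xs i) (U *m xs i).
pose be i := dotv (W *m xs i) (V *m xs i).
pose ga i := dotv (U *m xs i) (V *m xs i).
(* The difference quotient of the derivative in direction [V] as the point moves by h U. *)
pose p : {poly R} := K *: \sum_i (- (4%:R * nu)) *:
  ((rho W i * ga i - 2%:R * nu * b i * be i)%:P +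
  (- (2%:R * nu * b i * ga i) - nu * c i * be i)%:P * 'X +
  (- (nu * c i * ga i))%:P * 'X^2).
have -> : (fun W' => 'D_V L W') = (fun W' => K *
    \sum_i - (4%:R * nu * rho W' i * dotv (W' *m xs i) (V *m xs i))).
  by apply/funext => W'; exact: derive_emp_loss.
rewrite (@derive_along_poly R _ _ W U p).
  rewrite /p hornerZ horner_sum; congr (_ * _); apply: eq_bigr => i _.
  by rewrite !hornerE /= -/(b i) -/(be i) -/(ga i); ring.
move=> h; rewrite /p hornerZ horner_sum mulrCA -mulrDr; congr (_ * _).
rewrite mulr_sumr -big_split /=; apply: eq_bigr => i _.
rewrite rho_line mulmxDl -scalemxAl dotv_linl.
rewrite -/(b i) -/(c i) -/(be i) -/(ga i) !hornerE /=; ring.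
Qed.

(** [grad] and [hess] are built from coordinate directions; linearity of the derivative formulas in
    the direction extends them to any matrix. *)
Lemma sum_unit_dir (G : 'M[R]_(k, d) -> R) (u : 'rV[R]_(k * d)) :
  (forall c A B, G (c *: A + B) = c * G A + G B) ->
  \sum_p u 0 p * G (unit_dir p) = G (vec_mx u).
Proof.
move=> Glin.
have G0 : G 0 = 0.
  by have := Glin 1 0 0; rewrite scale1r addr0 mul1r => ?; lra.
rewrite {2}[u]row_sum_delta linear_sum /=.
apply: (big_ind2 (fun x y => x = G y)); first by rewrite G0.
  by move=> ? A ? B -> ->; rewrite -[A]scale1r Glin mul1r scale1r.
by move=> p _; rewrite linearZ /= -[_ *: _]addr0 Glin G0 addr0.
Qed.

Lemma grad_emp_loss (W : 'M[R]_(k, d)) (u : 'rV[R]_(k * d)) :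
  \sum_p u 0 p * grad L W 0 p = K * \sum_i - (4%:R * nu * rho W i *
     dotv (W *m xs i) (vec_mx u *m xs i)).
Proof.
under eq_bigr do rewrite /grad mxE derive_emp_loss.
apply: (sum_unit_dir (G := fun U => K * \sum_i - (4%:R * nu * rho W i *
     dotv (W *m xs i) (U *m xs i)))) => c A B.
rewrite /= [c * _]mulrCA -mulrDr; congr (_ * _).
  rewrite mulr_sumr -big_split /=.
apply: eq_bigr => i _; rewrite mulmxDl -scalemxAl dotv_linr; ring.
Qed.

Lemma hess_emp_loss (W : 'M[R]_(k, d)) (u : 'rV[R]_(k * d)) :
  (u *m hess L W *m u^T) 0 0 =
  K * \sum_i (8%:R * nu ^+ 2 * dotv (W *m xs i) (vec_mx u *m xs i) ^+ 2
     - 4%:R * nu * rho W i * dotv (vec_mx u *m xs i) (vec_mx u *m xs i)).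
Proof.
(* The Hessian as a bilinear form: the [nu ^+ 2] term is the Gauss-Newton part, the [rho] term
   carries the curvature of the network. It is expanded in the second argument first, then in the
   first. *)
pose H (U V : 'M[R]_(k, d)) := K * \sum_i
    (8%:R * nu ^+ 2 * dotv (W *m xs i) (U *m xs i) * dotv (W *m xs i) (V *m xs i)
     - 4%:R * nu * rho W i * dotv (U *m xs i) (V *m xs i)).
transitivity (H (vec_mx u) (vec_mx u)); last first.
  by congr (_ * _); apply: eq_bigr => i _; ring.
rewrite mxE; under eq_bigr do rewrite [u^T _ _]mxE mulrC.
rewrite -(sum_unit_dir (G := fun V => H (vec_mx u) V)); last first.
  move=> c A B; rewrite /H /= [c * _]mulrCA -mulrDr; congr (_ * _).
  rewrite mulr_sumr -big_split /=.
  by apply: eq_bigr => i _; rewrite mulmxDl -scalemxAl !dotv_linr; ring.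
apply: eq_bigr => q _; congr (_ * _).
rewrite -(sum_unit_dir (G := fun U => H U (unit_dir q))); last first.
  move=> c A B; rewrite /H /= [c * _]mulrCA -mulrDr; congr (_ * _).
  rewrite mulr_sumr -big_split /=.
  by apply: eq_bigr => i _; rewrite mulmxDl -scalemxAl !dotv_linr !dotv_linl; ring.
by rewrite mxE; apply: eq_bigr => p _; rewrite /hess mxE derive2_emp_loss.
Qed.

End Loss.

(** * Independence *)

Section NonnegInduction.
Context {d : measure_display} {T : measurableType d} {R : realType}.
Import HBNNSimple.
Local Open Scope ereal_scope.

(** The route from indicators through simple functions to monotone limits, with [Q] abstract because
    it is taken both for independence and for the normal density. *)
Lemma ge0_measurable_ind (Q : (T -> \bar R) -> Prop) :
  (forall A, measurable A -> Q (fun x => (\1_A x)%:E)) ->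
  (forall f g : T -> \bar R, measurable_fun [set: T] f -> measurable_fun [set: T] g ->
     (forall x, 0 <= f x) -> (forall x, 0 <= g x) -> Q f -> Q g ->
     Q (fun x => f x + g x)) ->
  (forall (c : R) (f : T -> \bar R), (0 <= c)%R -> measurable_fun [set: T] f ->
     (forall x, 0 <= f x) -> Q f -> Q (fun x => c%:E * f x)) ->
  (forall (g : (T -> \bar R)^nat), (forall n, measurable_fun [set: T] (g n)) ->
     (forall n x, 0 <= g n x) ->
     (forall x, {homo g^~ x : n m / (n <= m)%N >-> n <= m}) ->
     (forall n, Q (g n)) -> Q (fun x => limn (g^~ x))) ->
  forall f : T -> \bar R, measurable_fun [set: T] f -> (forall x, 0 <= f x) -> Q f.
Proof.
move=> Q1 QD QZ Qlim f mf f0.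
have Qsum (s : seq R) (A : R -> set T) (mA : forall r, measurable (A r)) :
    (forall r, r \in s -> (0 <= r)%R) ->
    Q (fun x => (\sum_(r <- s) r * \1_(A r) x)%:E).
  elim: s => [|r s ih] sge0.
    have := Q1 set0 measurable0.
    by congr Q; apply/funext => x; rewrite big_nil indic0.
  rewrite (_ : (fun _ => _) = (fun x => r%:E * (\1_(A r) x)%:E +
      (\sum_(r <- s) r * \1_(A r) x)%:E)); last first.
    by apply/funext => x; rewrite big_cons EFinD EFinM.
  have r0 : (0 <= r)%R by apply: sge0; rewrite mem_head.
  have s0 t : t \in s -> (0 <= t)%R by move=> ts; apply: sge0; rewrite in_cons ts orbT.
  apply: QD; last exact: ih.
  - apply/measurable_EFinP; apply: measurable_funM => //.
  - apply/measurable_EFinP; apply: measurable_sum => t.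
    by apply: measurable_funM => //; exact: measurable_indic.
  - by move=> x; rewrite mule_ge0.
  - move=> x; rewrite lee_fin big_seq; apply: sumr_ge0 => t ts.
    by rewrite mulr_ge0 // s0.
  - apply: QZ => //; last exact: Q1.
    by apply/measurable_EFinP.
have Qnn (h : {nnsfun T >-> R}) : Q (EFin \o h).
  rewrite (_ : _ \o _ = (fun x => (\sum_(r <- finmap.enum_fset (fset_set (range h)))
      r * \1_(h @^-1` [set r]) x)%:E)); last first.
    by apply/funext => x /=; rewrite {1}(fimfunE h) fsbig_finite.
  apply: Qsum => // r; rewrite in_fset_set// inE => -[x _ <-].
  exact: fun_ge0.
have fE : (fun x => limn (fun n => ((nnsfun_approx measurableT mf n) x)%:E)) = f.
  by apply/funext => x; apply/cvg_lim => //; exact: cvg_nnsfun_approx.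
rewrite -fE.
apply: (Qlim (fun n x => ((nnsfun_approx measurableT mf n) x)%:E)) => [n|n x|x n m nm|n].
- exact/measurable_EFinP.
- by rewrite lee_fin fun_ge0.
- by rewrite lee_fin; have /lefP := nd_nnsfun_approx measurableT mf nm; apply.
- exact: Qnn.
Qed.

End NonnegInduction.

(** * Product rule for integrals of independent variables *)

Section Independence.
Context {dT : measure_display} {T : measurableType dT} {R : realType}
  (P : probability T R).

Lemma prod_indic (I : finType) (A : I -> set T) (w : T) :
  \prod_i \1_(A i) w = \1_(\bigcap_(i in [set: I]) A i) w :> R.
Proof.
rewrite [RHS]indicE; case: (boolP (w \in _)) => [|/negP h].
  by rewrite inE => h; apply: big1 => i _; rewrite indicE mem_set//; exact: h.
have [i Ai] : exists i, ~ A i w.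
  by apply/existsNP => h'; apply: h; rewrite inE => i _; exact: h'.
by rewrite (bigD1 i)//= indicE memNset// mul0r.
Qed.

Lemma indep_comp (I : finType) (Z : I -> T -> R) (f : I -> R -> R) :
  (forall i, measurable_fun [set: R] (f i)) ->
  mutually_independent P Z -> mutually_independent P (fun i => f i \o Z i).
Proof.
move=> mf indZ B mB.
by apply: (indZ (fun i => f i @^-1` B i)) => i; rewrite -[_ @^-1` _]setTI; exact: mf.
Qed.

(** Induction on [s], the list of factors that are general functions while the others are
    indicators. With [s] empty this is the definition of independence; each step upgrades one factor
    by [ge0_measurable_ind], the others being frozen in [H]. *)
Lemma indep_mixed_prod (I : finType) (Z : I -> T -> R) (f : I -> R -> R) :
  (forall i, measurable_fun [set: T] (Z i)) -> mutually_independent P Z ->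
  (forall i, measurable_fun [set: R] (f i)) -> (forall i r, 0 <= f i r) ->
  (forall i, (\int[P]_w (f i (Z i w))%:E < +oo)%E) ->
  forall (s : seq I) (B : I -> set R), (forall i, measurable (B i)) ->
  let h i r := if i \in s then f i r else \1_(B i) r in
  (\int[P]_w (\prod_i h i (Z i w))%:E = \prod_i \int[P]_w (h i (Z i w))%:E)%E.
Proof.
move=> mZ indZ mf f0 ffin; elim=> [|j s ih] B mB h.
  rewrite {}/h.
  under eq_integral => w _.
    rewrite (_ : \prod_i _ = \prod_i \1_(Z i @^-1` B i) w); last by [].
    rewrite prod_indic; over.
  have mZB i : measurable (Z i @^-1` B i) by rewrite -[_ @^-1` _]setTI; exact: mZ.
  rewrite integral_indic//; last exact: fin_bigcap_measurable.
  rewrite setIT; apply: (etrans (indZ B mB)); apply: eq_bigr => i _.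
  by rewrite (integral_indic _ _ (mZB i))// setIT.
(* A repeated index changes nothing. *)
have [js|js] := boolP (j \in s).
  rewrite {}/h; have e i : (i \in j :: s) = (i \in s).
    by rewrite in_cons; case: eqP => // ->.
  under eq_integral do under eq_bigr do rewrite e.
  under [RHS]eq_bigr do under eq_integral do rewrite e.
  exact: ih.
have mh i : measurable_fun [set: R] (h i).
  by rewrite /h; case: (i \in _) => //; exact: measurable_indic.
have h0 i r : 0 <= h i r by rewrite /h; case: (i \in _).
pose H w := \prod_(i | i != j) h i (Z i w).
pose K := (\prod_(i | i != j) \int[P]_w (h i (Z i w))%:E)%E.
have mH : measurable_fun [set: T] H.
  rewrite /H; under eq_fun do rewrite big_mkcond.
  apply: measurable_prod => i _; case: (i != j) => //.
  exact: measurableT_comp.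
have H0 w : 0 <= H w by exact: prodr_ge0.
have K0 : (0 <= K)%E.
  apply: prode_ge0 => i _; apply: integral_ge0 => w _; rewrite lee_fin //.
(* Finiteness of [K] lets it be pulled out of the monotone limit below. *)
have Kfin : K \is a fin_num.
  rewrite /K; elim/big_rec: _ => // i x _ xf; rewrite fin_numM// ge0_fin_numE.
    rewrite /h; case: (i \in _) => //.
    under eq_integral do rewrite -[\1_(B i) _]/(\1_(Z i @^-1` B i) _).
    have mZB : measurable (Z i @^-1` B i) by rewrite -[_ @^-1` _]setTI; exact: mZ.
    by rewrite integral_indic// setIT (le_lt_trans (probability_le1 _ _))// ltry.
  by apply: integral_ge0 => w _; rewrite lee_fin.
pose Q (g : R -> \bar R) :=
  (\int[P]_w (g (Z j w) * (H w)%:E) = (\int[P]_w g (Z j w)) * K)%E.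
suff QS : Q (EFin \o f j).
  have hj : h j = f j by rewrite /h mem_head.
  rewrite (bigD1 j)//= -/K hj -[RHS]QS; apply: eq_integral => w _.
  by rewrite (bigD1 j)//= hj EFinM.
have mgZ (g : R -> \bar R) : measurable_fun [set: R] g ->
    measurable_fun [set: T] (fun w => g (Z j w)).
  by move=> mg; exact: measurableT_comp.
have mgH (g : R -> \bar R) : measurable_fun [set: R] g ->
    measurable_fun [set: T] (fun w => g (Z j w) * (H w)%:E)%E.
  move=> mg; apply: emeasurable_funM; first exact: mgZ.
  exact/measurable_EFinP.
apply: (@ge0_measurable_ind _ _ _ Q); rewrite /Q.
- move=> A mA.
  (* For an indicator, [A] becomes the set of index [j] and the induction hypothesis applies. *)
  pose B' i := if i == j then A else B i.
  have mB' i : measurable (B' i) by rewrite /B'; case: ifP.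
  have /= := ih B' mB'; rewrite [X in _ = X -> _](bigD1 j)//=.
  have e i r : i != j -> (if i \in s then f i r else \1_(B' i) r) = h i r.
    by move=> ij; rewrite /h in_cons (negbTE ij) /= /B' (negbTE ij).
  rewrite (eq_bigr (fun i => \int[P]_w (h i (Z i w))%:E)%E); last first.
    by move=> i ij; apply: eq_integral => w _; rewrite e.
  rewrite -/K (negbTE js) {1 2}/B' eqxx => <-.
  apply: eq_integral => w _; rewrite -EFinM (bigD1 j)//= (negbTE js) /B' eqxx.
  by congr (_ * _)%:E; apply: eq_bigr => i ij; rewrite -e.
- move=> g1 g2 mg1 mg2 g10 g20 Q1 Q2.
  rewrite (ge0_integralD _ measurableT)//; [|exact: mgZ|exact: mgZ].
  rewrite ge0_muleDl; [|exact: integral_ge0|exact: integral_ge0].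
  rewrite -Q1 -Q2 -ge0_integralD//; last 4 first.
  - by move=> w _; rewrite mule_ge0// lee_fin.
  - exact: mgH.
  - by move=> w _; rewrite mule_ge0// lee_fin.
  - exact: mgH.
  by apply: eq_integral => w _; rewrite ge0_muleDl.
- move=> c g c0 mg g0 Q1.
  rewrite ge0_integralZl_EFin//; last exact: mgZ.
  rewrite -muleA -Q1 -ge0_integralZl_EFin//; last 2 first.
  - by move=> w _; rewrite mule_ge0// lee_fin.
  - exact: mgH.
  by apply: eq_integral => w _; rewrite muleA.
- move=> g mg g0 ndg Qg.
  have cg r : cvgn (g^~ r) by apply: ereal_nondecreasing_is_cvgn; exact: ndg.
  rewrite (monotone_convergence P measurableT (g' := fun n w => g n (Z j w))); last 3 first.
  - by move=> n; exact: mgZ.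
  - by [].
  - by move=> w _; exact: ndg.
  rewrite muleC -limeMl//; last first.
    apply: ereal_nondecreasing_is_cvgn => n m nm.
    by apply: ge0_le_integral => //; [exact: mgZ|exact: mgZ|move=> w _; exact: ndg].
  rewrite (_ : (fun n => _) = fun n => \int[P]_w (g n (Z j w) * (H w)%:E))%E; last first.
    by apply/funext => n; rewrite Qg muleC.
  rewrite -monotone_convergence//; last 3 first.
  - by move=> n; exact: mgH.
  - by move=> n w _; rewrite mule_ge0// lee_fin.
  - by move=> w _ n m nm; rewrite lee_wpmul2r ?lee_fin//; exact: ndg.
  apply: eq_integral => w _; rewrite muleC -limeMl//.
  by congr (limn _); apply/funext => n; rewrite muleC.
- exact/measurable_EFinP.
- by move=> r; rewrite lee_fin.
Qed.

(** The mixed rule asks for functions nonnegative on all of R; the absolute value is one and fixes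
    each [Z i]. *)
Lemma indep_integral_prod (I : finType) (Z : I -> T -> R) :
  (forall i, measurable_fun [set: T] (Z i)) -> mutually_independent P Z ->
  (forall i w, 0 <= Z i w) -> (forall i, (\int[P]_w (Z i w)%:E < +oo)%E) ->
  (\int[P]_w (\prod_i Z i w)%:E = \prod_i \int[P]_w (Z i w)%:E)%E.
Proof.
move=> mZ indZ Z0 Zfin.
have nZ i w : `|Z i w| = Z i w by rewrite ger0_norm.
have e i : (i \in enum I) = true by rewrite mem_enum.
have mn (i : I) : measurable_fun [set: R] (fun r : R => `|r|) by exact: normr_measurable.
have fin i : (\int[P]_w (`|Z i w|)%:E < +oo)%E.
  by under eq_integral do rewrite nZ.
have /= := indep_mixed_prod mZ indZ mn (fun=> @normr_ge0 _ _) fin (enum I)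
  (B := fun=> setT) (fun=> measurableT).
under eq_integral do under eq_bigr do rewrite e nZ.
by move=> ->; apply: eq_bigr => i _; apply: eq_integral => w _; rewrite e nZ.
Qed.

End Independence.

(** * Independence of functions of disjoint rows *)

Section Grouping.
Context {dT : measure_display} {T : measurableType dT} {R : realType}
  (P : probability T R) (L J : finType) (X : L * J -> T -> R).
Hypothesis mX : forall ij, measurable_fun [set: T] (X ij).
Hypothesis indX : mutually_independent P X.

(** The pi-system that generates the sigma-algebra of row [i]. *)
Definition row_cylinders (i : L) : set (set T) :=
  [set A | exists2 B : J -> set R, forall j, measurable (B j) &
     A = \bigcap_(j in [set: J]) X (i, j) @^-1` B j].

Let mXB ij (B : set R) : measurable B -> measurable (X ij @^-1` B).
Proof. by move=> mB; rewrite -[_ @^-1` _]setTI; exact: mX. Qed.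

Lemma row_cylinders_measurable i : row_cylinders i `<=` measurable.
Proof.
move=> _ [B mB ->]; apply: fin_bigcap_measurable => // j _; exact: mXB.
Qed.

Lemma row_cylindersT i : row_cylinders i [set: T].
Proof. by exists (fun=> setT) => //; rewrite bigcapT. Qed.

Lemma row_cylindersI i : setI_closed (row_cylinders i).
Proof.
move=> _ _ [B mB ->] [B' mB' ->]; exists (fun j => B j `&` B' j).
  by move=> j; exact: measurableI.
by rewrite -bigcapI; apply: eq_bigcapr.
Qed.

Lemma measurable_row i j : measurable_fun setT
  (X (i, j) : g_sigma_algebraType (row_cylinders i) -> R).
Proof.
move=> _ B mB; rewrite setTI; apply: sub_gen_smallest.
exists (fun j' => if j' == j then B else setT); first by move=> j'; case: ifP.
apply/seteqP; split => [w Bw j' _ /=|w /(_ j I) /=]; last by rewrite eqxx.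
by case: eqP => // ->.
Qed.

(** The product over all entries is regrouped by rows; the factor of one row is the product rule
    again, with full sets in the other rows, which contribute 1. *)
Lemma row_cylinders_indep (A : L -> set T) : (forall i, row_cylinders i (A i)) ->
  P (\bigcap_(i in [set: L]) A i) = (\prod_(i : L) P (A i))%E.
Proof.
move=> hA.
have /choice[B hB] : forall i, exists B : J -> set R, (forall j, measurable (B j)) /\
    A i = \bigcap_(j in [set: J]) X (i, j) @^-1` B j.
  by move=> i; have [B mB ->] := hA i; exists B.
have pairE (F : L -> J -> \bar R) :
    (\prod_(p : L * J) F p.1 p.2 = \prod_i \prod_j F i j)%E.
  by rewrite pair_bigA.
transitivity (P (\bigcap_(p in [set: L * J]) X p @^-1` B p.1 p.2)).
  congr (P _); apply/seteqP; split => w h.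
    by move=> [i j] _ /=; have := h i I; rewrite (hB i).2 => /(_ j I).
  by move=> i _; rewrite (hB i).2 => j _; exact: (h (i, j) I).
apply: (etrans (indX _)) => [p|]; first exact: (hB p.1).1.
transitivity (\prod_i \prod_j P (X (i, j) @^-1` B i j))%E.
  by rewrite -pairE; apply: eq_bigr => -[].
apply: eq_bigr => i _.
pose B' (p : L * J) := if p.1 == i then B i p.2 else setT.
have mB' p : measurable (B' p).
  by rewrite /B'; case: ifP => // _; exact: (hB i).1.
transitivity (P (\bigcap_(p in [set: L * J]) X p @^-1` B' p)); last first.
  congr (P _); rewrite (hB i).2; apply/seteqP; split => w h.
    by move=> j _; have := h (i, j) I; rewrite /B' /= eqxx.
  move=> [i' j] _; rewrite /B' /=; case: eqP => // ->; exact: h.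
apply/esym/(etrans (indX mB')).
transitivity (\prod_i' \prod_j P (X (i', j) @^-1` B' (i', j)))%E.
  by rewrite -pairE; apply: eq_bigr => -[].
rewrite (bigD1 i)//= [X in (_ * X)%E]big1 => [|i' ii'].
  by rewrite mule1; apply: eq_bigr => j _; rewrite /B' /= eqxx.
apply: big1 => j _.
by rewrite /B' /= (negbTE ii') preimage_setT probability_setT.
Qed.

(** Dynkin's argument, one row at a time: [s] lists the rows whose event may be any set of the row
    sigma-algebra, the others still being cylinders. *)
Lemma row_sigma_indep (A : L -> set T) :
  (forall i, <<s row_cylinders i >> (A i)) ->
  P (\bigcap_(i in [set: L]) A i) = (\prod_(i : L) P (A i))%E.
Proof.
have sub i : <<s row_cylinders i >> `<=` measurable.
  by apply: smallest_sub; [exact: sigma_algebra_measurable|exact: row_cylinders_measurable].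
suff H (s : seq L) : forall A : L -> set T,
    (forall i, if i \in s then <<s row_cylinders i >> (A i) else row_cylinders i (A i)) ->
    P (\bigcap_(i in [set: L]) A i) = (\prod_(i : L) P (A i))%E.
  by move=> hA; have := H (enum L) A; apply => i; rewrite mem_enum; exact: hA.
elim: s => [|j s ih] {}A hA; first exact: row_cylinders_indep.
have hAs i : <<s row_cylinders i >> (A i).
  by have := hA i; case: ifP => // _; exact: sub_gen_smallest.
pose C := \bigcap_(i in [set i : L | i != j]) A i.
have mC : measurable C by apply: fin_bigcap_measurable => // i _; exact: sub.
pose K := (\prod_(i | i != j) P (A i))%E.
have K0 : (0 <= K)%E by apply: prode_ge0.
have Kfin : K \is a fin_num.
  rewrite /K; elim/big_rec: _ => // i x _ xf; rewrite fin_numM//.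
  by apply: fin_num_measure; exact: sub.
have capD (E : L -> set T) : \bigcap_(i in [set: L]) E i =
    E j `&` \bigcap_(i in [set i : L | i != j]) E i.
  apply/seteqP; split => [w Ew|w [Ej Ew] i _].
    by split; [exact: Ew|move=> i _; exact: Ew].
  by have [->//|ij] := eqVneq i j; exact: Ew.
rewrite capD (bigD1 j)//= -/C -/K.
have fK0 : 0 <= fine K by exact: fine_ge0.
(* As functions of the event in row [j], both sides are finite measures; they agree on the pi-system
   of cylinders, hence on the sigma-algebra it generates. *)
suff : mrestr P mC (A j) = mscale (NngNum fK0) P (A j).
  by rewrite /mrestr /mscale /= fineK// muleC.
apply: (@g_sigma_algebra_measure_unique _ _ _ (row_cylinders j) _ (fun=> setT)) => //.
- exact: row_cylinders_measurable.
- by move=> _; exact: row_cylindersT.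
- exact: bigcup_const.
- exact: row_cylindersI.
- move=> E cE; transitivity (P (E `&` C)); first by [].
  transitivity (P E * K)%E; last by rewrite muleC -{1}(fineK Kfin).
  pose A' i := if i == j then E else A i.
  have AjE : A' j = E by rewrite /A' eqxx.
  have cA' i : if i \in s then <<s row_cylinders i >> (A' i) else row_cylinders i (A' i).
    have [->|ij] := eqVneq i j.
      by rewrite AjE; case: ifP => // _; exact: sub_gen_smallest.
    by rewrite /A' (negbTE ij); have := hA i; rewrite in_cons (negbTE ij).
  have := ih A' cA'; rewrite capD (bigD1 j)//= AjE.
  rewrite (_ : \bigcap_(i in _) A' i = C); last first.
    by apply: eq_bigcapr => i /= ij; rewrite /A' (negbTE ij).
  rewrite (_ : (\prod_(i | _) P (A' i))%E = K)//.
  by apply: eq_bigr => i ij; rewrite /A' (negbTE ij).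
- move=> _; apply: (@le_lt_trans _ _ 1%E); last exact: ltry.
  by apply: (@probability_le1 _ _ _ P); exact: measurableI.
Qed.

Lemma row_functions_indep (h : L -> T -> R) :
  (forall i, measurable_fun setT (h i : g_sigma_algebraType (row_cylinders i) -> R)) ->
  mutually_independent P h.
Proof.
move=> mh B mB; apply: row_sigma_indep => i.
by have := mh i measurableT _ (mB i); rewrite setTI.
Qed.

End Grouping.

(** * Moments of Gaussian linear forms *)

Section NormalMoments.
Context {R : realType}.

(* [normal_prob] lives on [measurableTypeR R], whose display differs from that
   of the default measurable structure of [R]; hence the detour through [m]. *)
Lemma ge0_integral_normal_prob (a s : R) (m : {measure set R -> \bar R})
    (f : R -> \bar R) : (m : set R -> \bar R) = normal_prob a s ->
  measurable_fun [set: R] f -> (forall x, (0 <= f x)%E) ->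
  (\int[m]_x f x = \int[lebesgue_measure]_x (f x * (normal_pdf a s x)%:E))%E.
Proof.
move=> mE.
have mpdf : measurable_fun [set: measurableTypeR R] (fun x => (normal_pdf a s x)%:E).
  by apply/measurable_EFinP; exact: measurable_normal_pdf.
have pdf0 x : (0 <= (normal_pdf a s x)%:E)%E by rewrite lee_fin normal_pdf_ge0.
have mfp (h : R -> \bar R) : measurable_fun [set: R] h ->
    measurable_fun [set: measurableTypeR R] (fun x => h x * (normal_pdf a s x)%:E)%E.
  by move=> mh; apply: emeasurable_funM => //; exact: mh.
move: f; apply: ge0_measurable_ind.
- move=> A mA; rewrite integral_indic// setIT mE /normal_prob integral_mkcond.
  apply: eq_integral => x _ /=; rewrite patchE indicE.
  by case: ifP => _; rewrite ?mul1e ?mul0e.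
- move=> f g mf mg f0 g0 IHf IHg.
  rewrite ge0_integralD// IHf IHg -ge0_integralD//.
  - by apply: eq_integral => x _; rewrite ge0_muleDl.
  - by move=> x _; rewrite mule_ge0.
  - exact: mfp.
  - by move=> x _; rewrite mule_ge0.
  - exact: mfp.
- move=> c f c0 mf f0 IH.
  rewrite ge0_integralZl_EFin// IH -ge0_integralZl_EFin//.
  - by apply: eq_integral => x _; rewrite muleA.
  - by move=> x _; rewrite mule_ge0.
  - exact: mfp.
- move=> g mg g0 ndg IH.
  rewrite monotone_convergence//.
  rewrite (_ : (fun n => _) = fun n => \int[lebesgue_measure]_x
      (g n x * (normal_pdf a s x)%:E))%E; last by apply/funext => n; rewrite IH.
  rewrite -monotone_convergence//; last 3 first.
  - by move=> n; exact: mfp.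
  - by move=> n x _; rewrite mule_ge0.
  - by move=> x _ n k nk; rewrite lee_wpmul2r//; exact: ndg.
  apply: eq_integral => x _; rewrite muleC -limeMl//.
    by congr (limn _); apply/funext => n; rewrite muleC.
  by apply: ereal_nondecreasing_is_cvgn; exact: ndg.
Qed.

(** Completing the square: exp(b x) times the density of N(0,1) is exp(b^2 / 2) times the density of
    N(b,1). *)
Lemma normal_mgf (m : {measure set R -> \bar R}) (b : R) :
  (m : set R -> \bar R) = normal_prob 0 1 ->
  (\int[m]_x (expR (b * x))%:E = (expR (b ^+ 2 / 2))%:E)%E.
Proof.
move=> mE; rewrite (ge0_integral_normal_prob mE); last 2 first.
- apply/measurable_EFinP.
  rewrite (_ : (fun x => _) = expR \o ( *%R b))//.
  by apply: measurableT_comp; [exact: measurable_expR|exact: mulrl_measurable].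
- by move=> x; rewrite lee_fin expR_ge0.
transitivity (\int[lebesgue_measure]_x ((expR (b ^+ 2 / 2))%:E *
   (normal_pdf b 1 x)%:E))%E.
  apply: eq_integral => x _; rewrite -!EFinM; congr EFin.
  rewrite !normal_pdfE ?oner_eq0// mulrCA [RHS]mulrCA; congr (_ * _).
  rewrite /normal_fun -!expRD; congr expR.
  by rewrite subr0 expr1n; field.
rewrite ge0_integralZl_EFin ?expR_ge0//; last 2 first.
- by move=> x _; rewrite lee_fin normal_pdf_ge0.
- by apply/measurable_EFinP; exact: measurable_normal_pdf.
by rewrite integral_normal_pdf mule1.
Qed.

End NormalMoments.

(** * Elementary inequalities for the exponential *)

Section ExpInequalities.
Context {R : realType}.
Implicit Types z a : R.

Lemma expR_half_le2 : expR (2^-1) <= 2 :> R.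
Proof.
have : 2^-1 <= expR (- 2^-1) :> R by have := expR_ge1Dx (- 2^-1 : R); lra.
by rewrite expRN lef_pV2 ?posrE ?expR_gt0.
Qed.

(** One term of the exponential series at |z|, then exp |z| <= exp z + exp(-z). The factors 1 and -1
    match the shape of the moment generating function. *)
Lemma expr_norm_le_expR z n :
  `|z| ^+ n <= n`!%:R * (expR (1 * z) + expR ((- 1) * z)).
Proof.
rewrite mul1r mulN1r.
have f0 : 0 < n`!%:R :> R by rewrite ltr0n fact_gt0.
apply: (@le_trans _ _ (n`!%:R * expR `|z|)).
  rewrite -ler_pdivrMl// mulrC; case: n f0 => [|n] f0.
    by rewrite expr0 fact0 divr1 -expR0 ler_expR.
  by have := expR_ge1Dxn n (normr_ge0 z); lra.
rewrite ler_pM2l//; have := expR_ge0 z; have := expR_ge0 (- z).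
by case: (ger0P z) => _; lra.
Qed.

(** From exp(-a) <= 1 / (1 + a) <= 1 - a + a^2, as (1 - a + a^2)(1 + a) = 1 + a^3. The term [a]
    stands on the left so that only nonnegative functions get integrated. *)
Lemma expRN_quadratic a : 0 <= a -> expR (- a) + a <= 1 + a ^+ 2.
Proof.
move=> a0; have h : expR (- a) <= (1 + a)^-1.
  by rewrite expRN lef_pV2 ?posrE ?expR_gt0 ?expR_ge1Dx//; lra.
suff : (1 + a)^-1 <= 1 - a + a ^+ 2 by lra.
by rewrite -[_^-1]mul1r ler_pdivrMr; nra.
Qed.

(* Termwise comparison of the Taylor series of 2 cosh. *)
Lemma cosh_quarter_le z :
  expR (4^-1 * z) + expR ((- 4^-1) * z) <=
  2 + z ^+ 2 / 16 + (expR (1 * z) + expR ((- 1) * z)) / 256.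
Proof.
rewrite mul1r mulN1r mulNr [_ * z]mulrC.
pose S (x : R) := series (exp_coeff x).
have cS x : S x @ \oo --> expR x by exact: is_cvg_series_exp_coeff.
pose F n := 2 + z ^+ 2 / 16 + (S z n + S (- z) n) / 256 - (S (z / 4) n + S (- (z / 4)) n).
have cF : F @ \oo --> 2 + z ^+ 2 / 16 + (expR z + expR (- z)) / 256 -
    (expR (z / 4) + expR (- (z / 4))).
  apply: cvgB; last by apply: cvgD; exact: cS.
  apply: cvgD; first exact: cvg_cst.
  apply: cvgM; last exact: cvg_cst.
  by apply: cvgD; exact: cS.
rewrite -subr_ge0; apply: (cvgr_to_ge cF).
(* With three terms the gap is (2 + z^2) / 256. Later odd terms cancel, and an even term of degree n
   >= 4 is scaled by 4^-n <= 1/256. *)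
have F3 m : 0 <= F (m + 3)%N.
  elim: m => [|m IH].
    rewrite /F /S !seriesEnat /= !big_nat_recr//= !big_nil /exp_coeff /=.
    rewrite !expr0 !expr1 !factS fact0 !divr1; nra.
  apply: (le_trans IH); rewrite -subr_ge0 addSn.
  set n := (m + 3)%N; have n3 : (3 <= n)%N by rewrite leq_addl.
  have -> : F n.+1 - F n = (z ^+ n + (- z) ^+ n) / n`!%:R * (256^-1 - 4^-1 ^+ n).
    rewrite /F /S !seriesEnat /= !big_nat_recr//= /exp_coeff /=.
    by rewrite -mulNr !exprMn; field; rewrite pnatr_eq0 -lt0n fact_gt0.
  have [on|en] := boolP (odd n).
    by rewrite exprNn -signr_odd on mulN1r subrr !mul0r.
  apply: mulr_ge0; first apply: divr_ge0 => //; last first.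
    have n4 : (4 <= n)%N by move: n3 en; rewrite leq_eqVlt => /orP[/eqP <-|].
    rewrite subr_ge0 (_ : 256^-1 = 4^-1 ^+ 4); last by rewrite exprVn; congr _^-1; ring.
    by rewrite ler_wiXn2l//; lra.
  by apply: addr_ge0; rewrite exprn_even_ge0.
by exists 3%N => // m /= m3; rewrite -(subnK m3).
Qed.

End ExpInequalities.

(** * Integrals of nonnegative real functions *)

Section RealIntegrals.
Context {dT : measure_display} {T : measurableType dT} {R : realType}
  (P : probability T R).
Implicit Types f g : T -> R.
Local Notation Ex f := (\int[P]_w (f w)%:E)%E.

Lemma ge0_RintD f g : measurable_fun [set: T] f -> measurable_fun [set: T] g ->
  (forall w, 0 <= f w) -> (forall w, 0 <= g w) ->
  Ex (fun w => f w + g w) = (Ex f + Ex g)%E.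
Proof.
move=> mf mg f0 g0; under eq_integral do rewrite EFinD.
by rewrite ge0_integralD//; first [exact/measurable_EFinP | move=> w _; rewrite lee_fin].
Qed.

Lemma ge0_RintZ (c : R) f : measurable_fun [set: T] f ->
  (forall w, 0 <= f w) -> 0 <= c -> Ex (fun w => c * f w) = (c%:E * Ex f)%E.
Proof.
move=> mf f0 c0; under eq_integral do rewrite EFinM.
by rewrite ge0_integralZl_EFin//; first [exact/measurable_EFinP | move=> w _; rewrite lee_fin].
Qed.

Lemma ge0_Rint_le f g : measurable_fun [set: T] f -> measurable_fun [set: T] g ->
  (forall w, 0 <= f w) -> (forall w, f w <= g w) -> (Ex f <= Ex g)%E.
Proof.
move=> mf mg f0 fg; apply: ge0_le_integral => //.
- by move=> w _; rewrite lee_fin.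
- exact/measurable_EFinP.
- exact/measurable_EFinP.
- by move=> w _; rewrite lee_fin.
Qed.

Lemma Rint_cst (c : R) : Ex (fun=> c) = c%:E.
Proof. by rewrite integral_cst//= [P _]probability_setT mule1. Qed.

Lemma ge0_Rint_ge0 f : (forall w, 0 <= f w) -> (0 <= Ex f)%E.
Proof. by move=> f0; apply: integral_ge0 => w _; rewrite lee_fin. Qed.

Lemma ge0_Rint_sum (I : finType) (f : I -> T -> R) :
  (forall i, measurable_fun [set: T] (f i)) -> (forall i w, 0 <= f i w) ->
  Ex (fun w => \sum_i f i w) = (\sum_i Ex (f i))%E.
Proof.
move=> mf f0; under eq_integral do rewrite -sumEFin.
rewrite ge0_integral_sum//; first by move=> i; exact/measurable_EFinP.
by move=> i w _; rewrite lee_fin.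
Qed.

(** Replaces a bounded extended integral by a real number, so that real arithmetic can finish. *)
Lemma ge0_Rint_fine f (c : R) : (forall w, 0 <= f w) -> (Ex f <= c%:E)%E ->
  exists2 m : R, Ex f = m%:E & 0 <= m <= c.
Proof.
move=> f0 fc; have h := ge0_Rint_ge0 f0.
have ff : Ex f \is a fin_num by rewrite ge0_fin_numE// (le_lt_trans fc)// ltry.
exists (fine (Ex f)); first by rewrite fineK.
by rewrite -!lee_fin fineK// h fc.
Qed.

Lemma ge0_markov f (a : R) : measurable_fun [set: T] f ->
  (forall w, 0 <= f w) -> 0 < a ->
  (P [set w | (a <= f w)%R] <= (a^-1)%:E * Ex f)%E.
Proof.
move=> mf f0 a0.
have mA : measurable [set w | (a <= f w)%R].
  by rewrite -[X in measurable X]setTI; apply: measurable_fun_le => //.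
rewrite -[P _]mul1e -[X in (X * _)%E](_ : (a^-1 * a)%:E = 1%E); last first.
  by rewrite mulVf ?gt_eqF.
rewrite EFinM -muleA; apply: lee_wpmul2l; first by rewrite lee_fin invr_ge0 ltW.
have -> : P [set w | (a <= f w)%R] = Ex (\1_[set w | (a <= f w)%R]).
  by rewrite integral_indic// setIT.
have mi : measurable_fun [set: T] (\1_[set w | (a <= f w)%R] : T -> R).
  exact: measurable_indic.
rewrite -(ge0_RintZ mi)//; last exact: ltW.
apply: ge0_Rint_le => //.
- exact: measurable_funM.
- by move=> w; rewrite mulr_ge0// ltW.
- move=> w; rewrite indicE; case: (boolP (w \in _)); last by rewrite mulr0.
  by rewrite inE /= mulr1.
Qed.

End RealIntegrals.

Ltac meas := repeat match goal with
  | |- measurable_fun _ (fun _ => _ + _) => apply: measurable_funD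
  | |- measurable_fun _ (fun _ => _ * _) => apply: measurable_funM
  | |- measurable_fun _ (fun _ => _ ^+ _) => apply: measurable_funX
  | |- _ => done
  end.
Ltac nneg := move=> ?; repeat match goal with
  | |- is_true (0 <= _ + _) => apply: addr_ge0
  | |- is_true (0 <= _ * _) => apply: mulr_ge0
  | |- is_true (0 <= _ ^+ _) => exact: sqr_ge0
  | |- is_true (0 <= expR _) => exact: expR_ge0
  | |- is_true (0 <= _^-1) => rewrite invr_ge0; exact: ler0n
  | |- _ => done
  end.

(** * Moment bounds from the moment generating function *)

Section GaussianMoments.
Context {dT : measure_display} {T : measurableType dT} {R : realType}
  (P : probability T R).
Local Notation Ex f := (\int[P]_w (f w)%:E)%E.
Variables (z : T -> R) (q : R).
Hypothesis mz : measurable_fun [set: T] z.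
Hypothesis mgf : forall s, Ex (fun w => expR (s * z w)) = (expR (s ^+ 2 * q / 2))%:E.

Let mexp s : measurable_fun [set: T] (fun w => expR (s * z w)).
Proof.
apply: (@measurableT_comp _ _ _ _ _ _ expR); first exact: measurable_expR.
exact: measurable_funM.
Qed.

Let mpow n : measurable_fun [set: T] (fun w => z w ^+ n).
Proof. exact: measurable_funX. Qed.

(** At s = 1 and s = -1 the generating function is exp(q / 2) <= 2, whence the factor 4. *)
Lemma mgf_moment_le (n : nat) : q <= 1 ->
  (Ex (fun w => `|z w| ^+ n) <= (n`!%:R * 4)%:E)%E.
Proof.
move=> q1.
apply: (@le_trans _ _ (Ex (fun w => n`!%:R * (expR (1 * z w) + expR ((- 1) * z w))))).
  have mn : measurable_fun [set: T] (fun w => `|z w|) by exact: measurableT_comp.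
  apply: ge0_Rint_le; [by meas|by meas|by move=> w; exact: exprn_ge0|].
  by move=> w; exact: expr_norm_le_expR.
rewrite ge0_RintZ; [|by meas|by nneg|by rewrite ?invr_ge0 ?sqr_ge0 ?ler0n].
rewrite ge0_RintD; [|by meas|by meas|by nneg|by nneg].
rewrite !mgf -EFinD -EFinM lee_fin ler_wpM2l// sqrrN expr1n mul1r.
have : expR (q / 2) <= 2 :> R.
  by apply: le_trans expR_half_le2; rewrite ler_expR; lra.
lra.
Qed.

Hypothesis q1 : q = 1.

(** [cosh_quarter_le] in expectation: the left side is 2 exp(1/32) >= 2 + 1/16, the right side at
    most 2 + m2 / 16 + 1/64, so m2 >= 1 - 1/4. *)
Lemma mgf_second_moment_ge : ((3 / 4)%:E <= Ex (fun w => z w ^+ 2))%E.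
Proof.
have z20 w : 0 <= z w ^+ 2 by exact: sqr_ge0.
have h2 : (Ex (fun w => z w ^+ 2) <= 8%:E)%E.
  have := mgf_moment_le 2; rewrite q1 lexx => /(_ isT).
  under eq_integral do rewrite real_normK ?num_real//.
  by move/le_trans; apply; rewrite lee_fin (_ : 2`! = 2)%N//; lra.
have [m2 m2E _] := ge0_Rint_fine z20 h2.
rewrite m2E lee_fin.
have e0 s w : 0 <= expR (s * z w) by exact: expR_ge0.
have : (Ex (fun w => expR (4^-1 * z w) + expR ((- 4^-1) * z w)) <=
    Ex (fun w => 2 + (16^-1 * z w ^+ 2 + 256^-1 * (expR (1 * z w) + expR ((- 1) * z w)))))%E.
  apply: ge0_Rint_le; [by meas|by meas|by nneg|].
  by move=> w; have := cosh_quarter_le (z w); lra.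
rewrite ge0_RintD; [|by meas|by meas|by nneg|by nneg].
rewrite ge0_RintD; [|by meas|by meas|by nneg|by nneg].
rewrite Rint_cst.
rewrite ge0_RintD; [|by meas|by meas|by nneg|by nneg].
rewrite ge0_RintZ; [|by meas|by nneg|by rewrite ?invr_ge0 ?sqr_ge0 ?ler0n].
rewrite ge0_RintZ; [|by meas|by nneg|by rewrite ?invr_ge0 ?sqr_ge0 ?ler0n].
rewrite ge0_RintD; [|by meas|by meas|by nneg|by nneg].
rewrite m2E !mgf -!EFinM -!EFinD lee_fin q1 !sqrrN expr1n !mul1r.
have := expR_ge1Dx (4^-1 ^+ 2 * 1 / 2 : R); have := @expR_half_le2 R.
rewrite (_ : 4^-1 ^+ 2 * 1 / 2 = 32^-1 :> R); last by field.
lra.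
Qed.

(** In expectation exp(-t z^2) <= 1 - t z^2 + t^2 z^4; with E z^2 >= 3/4 and E z^4 <= 4! 4 = 96 this
    gives 1 - 6/6144 + 1/6144. *)
Lemma mgf_laplace_sqr_le :
  (Ex (fun w => expR (- (768^-1 * z w ^+ 2))) <= (expR (- (5 / 6144)))%:E)%E.
Proof.
(* 1/768 maximizes t / 4 - 96 t^2, the Chernoff exponent per sample at threshold 1/2; [t] is kept
   symbolic. *)
have [t tE] : exists t : R, t = 768^-1 by exists 768^-1.
have t0 : 0 <= t by rewrite tE invr_ge0 ler0n.
rewrite -tE.
have z20 w : 0 <= z w ^+ 2 by exact: sqr_ge0.
have h2 : (Ex (fun w => z w ^+ 2) <= 8%:E)%E.
  have := mgf_moment_le 2; rewrite q1 lexx => /(_ isT).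
  under eq_integral do rewrite real_normK ?num_real//.
  by move/le_trans; apply; rewrite lee_fin (_ : 2`! = 2)%N//; lra.
have [m2 m2E _] := ge0_Rint_fine z20 h2.
have := mgf_second_moment_ge; rewrite m2E lee_fin => m2ge.
have z40 w : 0 <= (z w ^+ 2) ^+ 2 by exact: sqr_ge0.
have h4 : (Ex (fun w => (z w ^+ 2) ^+ 2) <= 96%:E)%E.
  have := mgf_moment_le 4; rewrite q1 lexx => /(_ isT).
  under eq_integral do rewrite -[4%N]/(2 * 2)%N exprM real_normK ?num_real//.
  by move/le_trans; apply; rewrite lee_fin (_ : 4`! = 24)%N//; lra.
have [m4 m4E m4b] := ge0_Rint_fine z40 h4.
have ml : measurable_fun [set: T] (fun w => expR (- (t * z w ^+ 2))).
  apply: (@measurableT_comp _ _ _ _ _ _ expR); first exact: measurable_expR.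
  by apply: measurableT_comp => //; exact: measurable_funM.
have m4' : measurable_fun [set: T] (fun w => (z w ^+ 2) ^+ 2) by exact: measurable_funX.
have l0 w : 0 <= expR (- (t * z w ^+ 2)) by exact: expR_ge0.
have a0 w : 0 <= t * z w ^+ 2 by apply: mulr_ge0.
have : (Ex (fun w => expR (- (t * z w ^+ 2)) + t * z w ^+ 2) <=
    Ex (fun w => 1 + t ^+ 2 * (z w ^+ 2) ^+ 2))%E.
  apply: ge0_Rint_le; [by meas|by meas|by nneg|].
  by move=> w; have := expRN_quadratic (a0 w); rewrite exprMn.
have le1 : (Ex (fun w => expR (- (t * z w ^+ 2))) <= 1%:E)%E.
  rewrite -[X in (_ <= X)%E](Rint_cst P); apply: ge0_Rint_le => // w.
  by rewrite -expR0 ler_expR oppr_le0.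
have [lm lmE _] := ge0_Rint_fine l0 le1; rewrite lmE lee_fin.
rewrite ge0_RintD; [|by meas|by meas|by nneg|by nneg].
rewrite ge0_RintD; [|by meas|by meas|by nneg|by nneg].
rewrite ge0_RintZ; [|by meas|by nneg|by rewrite ?sqr_ge0].
rewrite ge0_RintZ; [|by meas|by nneg|by rewrite ?sqr_ge0].
rewrite Rint_cst m2E m4E lmE -!EFinM -!EFinD lee_fin.
have := expR_ge1Dx (- (5 / 6144) : R); move: m4b => /andP[].
have -> : t ^+ 2 * m4 = m4 / 768 / 768.
  by rewrite tE expr2 mulrC mulrA.
rewrite tE; lra.
Qed.

End GaussianMoments.

(** * Linear forms of the Gaussian sample *)

Section GaussianDesign.
Context {dT : measure_display} {T : measurableType dT} {R : realType}
  (P : probability T R).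
Local Notation Ex f := (\int[P]_w (f w)%:E)%E.

Lemma indep_mgf_sum (I : finType) (X : I -> T -> R) (b : I -> R) :
  (forall i, measurable_fun [set: T] (X i)) -> mutually_independent P X ->
  (forall i s, Ex (fun w => expR (s * X i w)) = (expR (s ^+ 2 / 2))%:E) ->
  Ex (fun w => expR (\sum_i b i * X i w)) = (expR ((\sum_i b i ^+ 2) / 2))%:E.
Proof.
move=> mX indX mgfX.
have mexp i : measurable_fun [set: R] (fun r : R => expR (b i * r)).
  rewrite (_ : (fun r => _) = expR \o ( *%R (b i)))//.
  by apply: measurableT_comp; [exact: measurable_expR|exact: mulrl_measurable].
under eq_integral do rewrite expR_sum.
rewrite (indep_integral_prod (P := P) (Z := fun i w => expR (b i * X i w))).
- under eq_bigr do rewrite mgfX.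
  by rewrite prodEFin -expR_sum mulr_suml.
- by move=> i; exact: measurableT_comp (mexp i) (mX i).
- exact: (indep_comp mexp indX).
- by move=> i w; exact: expR_ge0.
- by move=> i; rewrite mgfX ltry.
Qed.

Variables (n d : nat) (X : 'I_n * 'I_d -> T -> R).
Hypothesis mX : forall ij, measurable_fun [set: T] (X ij).
Hypothesis indX : mutually_independent P X.
Hypothesis mgfX : forall ij s, Ex (fun w => expR (s * X ij w)) = (expR (s ^+ 2 / 2))%:E.

Definition sample (w : T) (i : 'I_n) : 'cV[R]_d := \col_j X (i, j) w.

(** The form is a combination of the whole array with weights [b] supported on row [i]. *)
Lemma mgf_dot_sample (u : 'cV[R]_d) i s :
  Ex (fun w => expR (s * dotv u (sample w i))) = (expR (s ^+ 2 * dotv u u / 2))%:E.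
Proof.
pose b (p : 'I_n * 'I_d) := if p.1 == i then s * u p.2 0 else 0.
have sumb (F : 'I_n * 'I_d -> R) : (forall p, p.1 != i -> F p = 0) ->
    \sum_p F p = \sum_j F (i, j).
  move=> F0; transitivity (\sum_i' \sum_j F (i', j)).
    by rewrite pair_bigA; apply: eq_bigr => -[].
  rewrite (bigD1 i)//= [X in _ + X]big1 ?addr0// => i' ii'.
  by apply: big1 => j _; rewrite F0.
have := indep_mgf_sum b mX indX mgfX.
rewrite (_ : \sum_p b p ^+ 2 = s ^+ 2 * dotv u u); last first.
  rewrite sumb; last by move=> p pi; rewrite /b (negbTE pi) expr0n.
  by rewrite /dotv mulr_sumr; apply: eq_bigr => j _; rewrite /b eqxx exprMn -expr2.
move=> <-; apply: eq_integral => w _; congr (expR _)%:E.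
rewrite sumb; last by move=> p pi; rewrite /b (negbTE pi) mul0r.
by rewrite /dotv mulr_sumr; apply: eq_bigr => j _; rewrite /b eqxx mxE mulrA.
Qed.

Lemma measurable_row_dot (u : 'cV[R]_d) i : measurable_fun setT
  ((fun w => dotv u (sample w i)) : g_sigma_algebraType (row_cylinders X i) -> R).
Proof.
rewrite /dotv; apply: measurable_sum => j; apply: measurable_funM => //.
under eq_fun do rewrite mxE.
apply: measurable_row.
Qed.

Lemma measurable_dot (u : 'cV[R]_d) i :
  measurable_fun [set: T] (fun w => dotv u (sample w i)).
Proof.
rewrite /dotv; apply: measurable_sum => j; apply: measurable_funM => //.
by under eq_fun do rewrite mxE; exact: mX.
Qed.

Lemma dot_sample_indep (u : 'cV[R]_d) :
  mutually_independent P (fun i w => dotv u (sample w i)).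
Proof. by apply: (row_functions_indep mX indX) => i; exact: measurable_row_dot. Qed.

(** Chernoff bound at t = 1/768: the n factors give exp(-5 n / 6144), and the threshold n / 2 costs
    exp(n / 1536) = exp(4 n / 6144). *)
Lemma sqr_dot_sum_lower_tail (u : 'cV[R]_d) : dotv u u = 1 ->
  (P [set w | (\sum_i dotv u (sample w i) ^+ 2 <= n%:R / 2)%R] <=
   (expR (- (n%:R / 6144)))%:E)%E.
Proof.
move=> u1.
have [t tE] : exists t : R, t = 768^-1 by exists 768^-1.
have t0 : 0 < t by rewrite tE invr_gt0 ltr0n.
pose f (r : R) := expR (- (t * r ^+ 2)).
have mf : measurable_fun [set: R] f.
  apply: (@measurableT_comp _ _ _ _ _ _ expR); first exact: measurable_expR.
  by apply: measurableT_comp => //; apply: measurable_funM => //; exact: measurable_funX.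
pose Z i w := f (dotv u (sample w i)).
have mZ i : measurable_fun [set: T] (Z i).
  exact: measurableT_comp mf (measurable_dot u i).
have Z0 i w : 0 <= Z i w by exact: expR_ge0.
have EZ i : (Ex (Z i) <= (expR (- (5 / 6144)))%:E)%E.
  rewrite /Z /f tE; apply: (mgf_laplace_sqr_le (q := dotv u u)) => //.
    exact: measurable_dot.
  by move=> s; exact: mgf_dot_sample.
have Eprod : (Ex (fun w => (\prod_i Z i w)%R) <= (expR (- (5 / 6144 * n%:R)))%:E)%E.
  rewrite indep_integral_prod//; last 2 first.
  - exact: (indep_comp (f := fun=> f) (fun=> mf) (dot_sample_indep u)).
  - by move=> i; apply: le_lt_trans (EZ i) _; exact: ltry.
  have /choice[m mE] i : exists m : R, Ex (Z i) = m%:E /\ 0 <= m <= expR (- (5 / 6144)).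
    by have [m mE mb] := ge0_Rint_fine (Z0 i) (EZ i); exists m.
  under eq_bigr do rewrite (mE _).1.
  rewrite prodEFin lee_fin -mulNr mulrC expRM_natl.
  have -> : expR (- (5 / 6144)) ^+ n = \prod_(i < n) expR (- (5 / 6144)) :> R.
    by rewrite prodr_const card_ord.
  by apply: ler_prod => i _; exact: (mE i).2.
have prodE w : \prod_i Z i w = expR (- (t * \sum_i dotv u (sample w i) ^+ 2)).
  by rewrite mulr_sumr -sumrN expR_sum.
have sub : [set w | (\sum_i dotv u (sample w i) ^+ 2 <= n%:R / 2)%R] =
    [set w | (expR (- (t * (n%:R / 2))) <= \prod_i Z i w)%R].
  by apply/seteqP; split => w /=; rewrite prodE ler_expR lerN2 ler_pM2l.
rewrite sub.
have mp : measurable_fun [set: T] (fun w => \prod_i Z i w) by exact: measurable_prod.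
have p0 w : 0 <= \prod_i Z i w by exact: prodr_ge0.
apply: le_trans (ge0_markov P mp p0 (expR_gt0 _)) _.
apply: (@le_trans _ _ ((expR (- (t * (n%:R / 2))))^-1%:E * (expR (- (5 / 6144 * n%:R)))%:E)%E).
  by apply: lee_wpmul2l => //; rewrite lee_fin invr_ge0 expR_ge0.
rewrite -EFinM lee_fin -expRN opprK -expRD ler_expR tE; lra.
Qed.

End GaussianDesign.

(** * A uniform lower bound from a grid *)

Section UnionBound.
Context {dT : measure_display} {T : measurableType dT} {R : realType}
  (P : probability T R).

Lemma union_bound (I : finType) (A : I -> set T) (p : R) :
  (forall i, measurable (A i)) -> (forall i, (P (A i) <= p%:E)%E) ->
  (P (\bigcup_(i in [set: I]) A i) <= (#|I|%:R * p)%:E)%E.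
Proof.
move=> mA pA.
have H (s : seq I) : measurable (\big[setU/set0]_(i <- s) A i) /\
    (P (\big[setU/set0]_(i <- s) A i) <= ((size s)%:R * p)%:E)%E.
  elim: s => [|i s [ms IH]]; first by rewrite big_nil measure0 mul0r.
  rewrite big_cons /= -natr1 mulrDl mul1r addrC EFinD; split.
    by apply: measurableU; [exact: mA|exact: ms].
  apply: (le_trans (measureU2 P (mA i) ms)).
  by apply: leeD; [exact: pA|exact: IH].
have -> : \bigcup_(i in [set: I]) A i = \big[setU/set0]_(i <- enum I) A i.
  rewrite -bigcup_seq (_ : [set: I] = [set` enum I])//.
  by apply/seteqP; split => i //= _; rewrite mem_enum.
by have [_] := H (enum I); rewrite -cardE.
Qed.

End UnionBound.

Section Grid.
Context {R : realType} {d : nat}.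
Implicit Types u g e x : 'cV[R]_d.

(** Points of spacing 1 / D in the cube [-1, 1]^d, indexed by a finite type of cardinality (2 D +
    1)^d for the union bound. *)
Definition grid (D : nat) (m : {ffun 'I_d -> 'I_(2 * D).+1}) : 'cV[R]_d :=
  \col_j ((m j)%:R / D%:R - 1).
Arguments grid D m : clear implicits.

Lemma grid_approx (D : nat) u : (0 < D)%N -> dotv u u = 1 ->
  exists m, dotv (u - grid D m) (u - grid D m) <= d%:R / D%:R ^+ 2.
Proof.
move=> D0 u1.
have Dp : 0 < D%:R :> R by rewrite ltr0n.
have uj j : -1 <= u j 0 <= 1.
  suff : u j 0 * u j 0 <= 1 by move=> h; apply/andP; split; nra.
  rewrite -u1 /dotv (bigD1 j)//= lerDl; apply: sumr_ge0 => i _.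
  by rewrite -expr2 sqr_ge0.
(* Coordinates are rounded down; (u_j + 1) D <= 2 D keeps the [inord] index in range, and each error
   is at most 1 / D. *)
pose m : {ffun 'I_d -> 'I_(2 * D).+1} := [ffun j => inord (Num.truncn ((u j 0 + 1) * D%:R))].
exists m; rewrite /dotv.
rewrite (_ : d%:R / D%:R ^+ 2 = \sum_(j < d) (D%:R ^-1) ^+ 2 :> R); last first.
  by rewrite sumr_const card_ord exprVn -[RHS]mulr_natl.
apply: ler_sum => j _; rewrite !mxE /m ffunE.
have /andP[ul uu] := uj j.
have t0 : 0 <= (u j 0 + 1) * D%:R by apply: mulr_ge0; lra.
have /andP[tl tu] := truncn_itv t0.
rewrite inordK; last first.
  rewrite ltnS -(ler_nat R); apply: (le_trans tl).
  by rewrite natrM ler_pM2r//; lra.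
set t := Num.truncn _ in tl tu *.
rewrite -expr2 ler_sqr ?nnegrE ?invr_ge0 ?(ltW Dp)//; last first.
  by rewrite opprD opprK addrA addrAC subr_ge0 ler_pdivrMr.
rewrite -(ler_pM2r Dp) mulVf ?gt_eqF// mulrBl mulrBl mul1r divfK ?gt_eqF//.
rewrite -natr1 in tu; lra.
Qed.

(** With e = g . x - u . x the claim is (g . x / 2 - 2 e)^2 >= 0. *)
Lemma dotv_sqr_perturb u g x :
  3 / 4 * dotv g x ^+ 2 - 3 * dotv (u - g) x ^+ 2 <= dotv u x ^+ 2.
Proof.
have -> : dotv (u - g) x = dotv u x - dotv g x.
  by rewrite -[u - g]addrC -scaleN1r dotv_linl mulN1r addrC.
have := sqr_ge0 (dotv g x / 2 - 2 * (dotv g x - dotv u x)); nra.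
Qed.

Lemma dotv_CauchySchwarz u x : dotv u x ^+ 2 <= dotv u u * dotv x x.
Proof. exact: sum_CauchySchwarz. Qed.

Lemma dotv_sqnorm_perturb u g :
  3 / 4 * dotv u u - 3 * dotv (u - g) (u - g) <= dotv g g.
Proof.
rewrite /dotv !mulr_sumr -sumrB; apply: ler_sum => j _; rewrite !mxE.
have := sqr_ge0 (u j 0 / 2 - 2 * (u j 0 - g j 0)); nra.
Qed.

(** With D = 8 d^2 the squared rounding error of a unit vector is at most 1 / (64 d^3). Against the
    crude bound 8 n d^2 on the squared norms it contributes at most n / (8 d) <= n / 64, so the
    constant 1/2 of the grid drops only to 1/8. Homogeneity covers the other vectors. *)
Lemma grid_lower_bound (n : nat) (xs : 'I_n -> 'cV[R]_d) : (8 <= d)%N ->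
  (forall m, n%:R / 2 * dotv (grid (8 * d ^ 2) m) (grid (8 * d ^ 2) m) <=
     \sum_i dotv (grid (8 * d ^ 2) m) (xs i) ^+ 2) ->
  \sum_i dotv (xs i) (xs i) <= 8 * n%:R * d%:R ^+ 2 ->
  forall u, n%:R / 8 * dotv u u <= \sum_i dotv u (xs i) ^+ 2.
Proof.
move=> d8 hgrid hnorm.
set D := (8 * d ^ 2)%N in hgrid.
have d8R : 8 <= d%:R :> R by rewrite ler_nat.
have n0 : 0 <= n%:R :> R by rewrite ler0n.
have D0 : (0 < D)%N by rewrite /D muln_gt0 expn_gt0; case: d d8.
have unit_case u : dotv u u = 1 -> n%:R / 8 <= \sum_i dotv u (xs i) ^+ 2.
  move=> u1; have [m he] := grid_approx D0 u1.
  set g := grid D m in he; set e2 := dotv _ _ in he.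
  have De : D%:R = 8 * d%:R ^+ 2 :> R by rewrite /D natrM natrX.
  have e20 : 0 <= e2 by exact: dotv_ge0.
  have he1 : e2 * (64 * d%:R ^+ 3) <= 1.
    move: he; rewrite De ler_pdivlMr; last by apply: exprn_gt0; nra.
    move=> h; rewrite -(@ler_pM2r _ d%:R); last by lra.
    by apply: le_trans (le_trans h _); rewrite ?mul1r// le_eqVlt; apply/orP; left; apply/eqP; ring.
  have he2 : e2 * (8 * n%:R * d%:R ^+ 2) <= n%:R / 64.
    have : e2 * (64 * d%:R ^+ 2) * 8 <= 1.
      apply: le_trans he1; rewrite -mulrA ler_wpM2l// [d%:R ^+ 3]exprS.
      have := sqr_ge0 (d%:R : R); nra.
    nra.
  have he3 : e2 <= 1 / 512.
    have : 512 <= d%:R ^+ 3 :> R.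
      have h2 : 64 <= d%:R ^+ 2 :> R by rewrite expr2; nra.
      by rewrite exprS; nra.
    nra.
  have hg := dotv_sqnorm_perturb u g; rewrite u1 -/e2 in hg.
  have hs : 3 / 4 * \sum_i dotv g (xs i) ^+ 2 - 3 * (e2 * \sum_i dotv (xs i) (xs i)) <=
      \sum_i dotv u (xs i) ^+ 2.
    rewrite !mulr_sumr -sumrB; apply: ler_sum => i _.
    apply: le_trans (dotv_sqr_perturb u g (xs i)).
    by rewrite lerD2l lerN2 ler_pM2l//; exact: dotv_CauchySchwarz.
  have h3 : e2 * \sum_i dotv (xs i) (xs i) <= n%:R / 64.
    by apply: le_trans he2; rewrite ler_wpM2l.
  have := hgrid m; rewrite -/g => hgm.
  have h4 : n%:R / 2 * (3 / 4 - 3 * (1 / 512)) <= n%:R / 2 * dotv g g.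
    by rewrite ler_wpM2l//; lra.
  lra.
move=> u; have [u0|u0] := eqVneq (dotv u u) 0.
  by rewrite u0 mulr0; apply: sumr_ge0 => i _; exact: sqr_ge0.
have up : 0 < dotv u u by rewrite lt_neqAle eq_sym u0 dotv_ge0.
pose a := (Num.sqrt (dotv u u))^-1.
have a2 : a ^+ 2 = (dotv u u)^-1 by rewrite /a exprVn sqr_sqrtr// ltW.
have := unit_case (a *: u).
rewrite dotvZl dotvC dotvZl mulrA -expr2 a2 mulVf// => /(_ erefl).
under eq_bigr do rewrite dotvZl exprMn a2.
by rewrite -mulr_sumr ler_pdivlMl// mulrC.
Qed.

End Grid.

Arguments grid {R d} D m.

(** * Variance bound *)

Section SecondMomentTail.
Context {dT : measure_display} {T : measurableType dT} {R : realType}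
  (P : probability T R).
Local Notation Ex f := (\int[P]_w (f w)%:E)%E.

(** The product rule with every factor other than [i] and [j] replaced by the constant 1. *)
Lemma indep_integral_mul (I : finType) (Y : I -> T -> R) (m : I -> R) i j :
  (forall i, measurable_fun [set: T] (Y i)) -> mutually_independent P Y ->
  (forall i w, 0 <= Y i w) -> (forall i, Ex (Y i) = (m i)%:E) -> i != j ->
  Ex (fun w => Y i w * Y j w) = (m i * m j)%:E.
Proof.
move=> mY indY Y0 Ym ij.
pose f k (r : R) := if (k == i) || (k == j) then `|r| else 1.
have mf k : measurable_fun [set: R] (f k).
  by rewrite /f; case: (_ || _) => //; exact: normr_measurable.
have f0 k r : 0 <= f k r by rewrite /f; case: ifP.
pose Z k := f k \o Y k.
have Zij k : (k == i) || (k == j) -> Z k = Y k.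
  by move=> h; apply/funext => w; rewrite /Z /f /= h ger0_norm.
have Z1 k : ~~ ((k == i) || (k == j)) -> Z k = fun=> 1.
  by move=> /negbTE h; apply/funext => w; rewrite /Z /f /= h.
have prodij (F : I -> \bar R) :
    (forall k, ~~ ((k == i) || (k == j)) -> F k = 1%E) -> (\prod_k F k = F i * F j)%E.
  move=> F1; rewrite (bigD1 i)//= (bigD1 j) 1?eq_sym//=.
  rewrite [X in (_ * (_ * X))%E]big1 ?mule1// => k kij.
  by apply: F1; rewrite negb_or.
have := indep_integral_prod (P := P) (Z := Z).
rewrite prodij; last by move=> k h; rewrite (Z1 k h) Rint_cst.
rewrite !Zij ?eqxx ?orbT// !Ym -EFinM => <-.
- apply: eq_integral => w _; rewrite -prodEFin prodij.
    by rewrite !Zij ?eqxx ?orbT// EFinM.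
  by move=> k h; rewrite Z1.
- by move=> k; exact: measurableT_comp (mf k) (mY k).
- exact: indep_comp.
- by move=> k w; exact: f0.
- move=> k; have [h|h] := boolP ((k == i) || (k == j)).
    by rewrite Zij// Ym ltry.
  by rewrite Z1// Rint_cst ltry.
Qed.

(** Chebyshev's inequality around the true mean [M] <= |I| a, the variance being at most the sum of
    the second moments. *)
Lemma indep_sum_upper_tail (I : finType) (Y : I -> T -> R) (a b lam : R) :
  (forall i, measurable_fun [set: T] (Y i)) -> mutually_independent P Y ->
  (forall i w, 0 <= Y i w) -> (forall i, (Ex (Y i) <= a%:E)%E) ->
  (forall i, (Ex (fun w => Y i w ^+ 2) <= b%:E)%E) -> 0 < lam ->
  (P [set w | (#|I|%:R * a + lam <= \sum_i Y i w)%R] <=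
   ((lam ^+ 2)^-1 * (#|I|%:R * b))%:E)%E.
Proof.
move=> mY indY Y0 Ya Yb lam0.
have /choice[m mE] i : exists m : R, Ex (Y i) = m%:E /\ 0 <= m <= a.
  by have [m ? ?] := ge0_Rint_fine (Y0 i) (Ya i); exists m.
have /choice[s sE] i : exists s : R, Ex (fun w => Y i w ^+ 2) = s%:E /\ 0 <= s <= b.
  by have [m' ? ?] := ge0_Rint_fine (fun w => sqr_ge0 (Y i w)) (Yb i); exists m'.
pose S w := \sum_i Y i w; pose M := \sum_i m i.
have mS : measurable_fun [set: T] S by exact: measurable_sum.
have S0 w : 0 <= S w by exact: sumr_ge0.
have M0 : 0 <= M by apply: sumr_ge0 => i _; have /andP[] := (mE i).2.
have ES : Ex S = M%:E.
  by rewrite ge0_Rint_sum// -sumEFin; apply: eq_bigr => i _; exact: (mE i).1.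
(* In the expanded square the diagonal terms are at most [b] and the off-diagonal ones factor as m_i
   m_j. *)
have ES2 : (Ex (fun w => (S w ^+ 2)%R) <= (#|I|%:R * b + M ^+ 2)%:E)%E.
  under eq_integral do rewrite expr2 /S mulr_suml.
  rewrite ge0_Rint_sum; last 2 first.
  - by move=> i; apply: measurable_funM.
  - by move=> i w; rewrite mulr_ge0// sumr_ge0.
  have -> : #|I|%:R * b + M ^+ 2 = \sum_i (b + m i * M).
    by rewrite big_split /= sumr_const -mulr_suml -/M expr2 mulr_natl.
  rewrite -sumEFin; apply: lee_sum => i _.
  under eq_integral do rewrite mulr_sumr.
  rewrite ge0_Rint_sum; last 2 first.
  - by move=> j; apply: measurable_funM.
  - by move=> j w; rewrite mulr_ge0.
  rewrite (bigD1 i)//= EFinD; apply: leeD.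
    under eq_integral do rewrite -expr2.
    exact: Yb.
  rewrite (eq_bigr (fun j => (m i * m j)%:E)); last first.
    move=> j ij; apply: (indep_integral_mul mY indY Y0 (fun i => (mE i).1)).
    by rewrite eq_sym.
  rewrite sumEFin lee_fin -mulr_sumr ler_wpM2l//; first by have /andP[] := (mE i).2.
  rewrite /M [leRHS](bigD1 i)//= lerDr; by have /andP[] := (mE i).2.
have [E2 E2E E2b] := ge0_Rint_fine (fun w => sqr_ge0 (S w)) ES2.
have mSM : measurable_fun [set: T] (fun w => (S w - M) ^+ 2).
  by apply: measurable_funX; apply: measurable_funB.
have Var : (Ex (fun w => ((S w - M) ^+ 2)%R) <= (#|I|%:R * b)%:E)%E.
  (* The cross term is moved to the left so that only nonnegative functions are integrated. *)
  have : Ex (fun w => (S w - M) ^+ 2 + (2 * M) * S w) = Ex (fun w => S w ^+ 2 + M ^+ 2).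
    by apply: eq_integral => w _; congr EFin; ring.
  have mS2 : measurable_fun [set: T] (fun w => S w ^+ 2) by exact: measurable_funX.
  have M20 : 0 <= 2 * M by rewrite mulr_ge0.
  rewrite ge0_RintD//; last 3 first.
  - exact: measurable_funM.
  - by move=> w; exact: sqr_ge0.
  - by move=> w; exact: mulr_ge0.
  rewrite ge0_RintZ// ES ge0_RintD//; last 2 first.
  - by move=> w; exact: sqr_ge0.
  - by move=> w; exact: sqr_ge0.
  rewrite Rint_cst E2E -EFinD -EFinM.
  case: (Ex (fun w => (S w - M) ^+ 2)) => [v|//|//] [vE].
  by rewrite lee_fin; move: E2b => /andP[_]; nra.
apply: (@le_trans _ _ (P [set w | (lam ^+ 2 <= (S w - M) ^+ 2)%R])).
  apply: le_measure; rewrite ?inE.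
  - by rewrite -[X in measurable X]setTI; apply: measurable_fun_le.
  - by rewrite -[X in measurable X]setTI; apply: measurable_fun_le.
  - move=> w /= h; rewrite ler_sqr ?nnegrE ?(ltW lam0)//.
      suff : M <= #|I|%:R * a by rewrite /S; lra.
      rewrite mulr_natl -sumr_const; apply: ler_sum => i _.
      by have /andP[] := (mE i).2.
    suff : M <= #|I|%:R * a by rewrite /S; lra.
    rewrite mulr_natl -sumr_const; apply: ler_sum => i _.
    by have /andP[] := (mE i).2.
apply: le_trans (ge0_markov P mSM (fun w => sqr_ge0 _) (exprn_gt0 2 lam0)) _.
rewrite EFinM; apply: lee_wpmul2l => //.
by rewrite lee_fin invr_ge0 exprn_ge0// ltW.
Qed.

End SecondMomentTail.

(** * Approximate second-order critical points *)

Section QuadraticForm.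
Context {R : realType} {k d : nat} (v : 'rV[R]_k) (W : 'M[R]_(k, d)).

(** The trace of W^T diag(v) W, split into the contributions of the rows. *)
Definition weight : R := \sum_l v 0 l * dotv (row l W)^T (row l W)^T.

Lemma mulmx_dotv x l : (W *m x) l 0 = dotv (row l W)^T x.
Proof. by rewrite mxE; apply: eq_bigr => j _; rewrite !mxE. Qed.

Lemma net_dotv x : net v W x = \sum_l v 0 l * dotv (row l W)^T x ^+ 2.
Proof. by rewrite /net mxE; apply: eq_bigr => l _; rewrite mxE mulmx_dotv. Qed.

Lemma trace_weight : \tr (W^T *m diag_mx v *m W) = weight.
Proof.
rewrite /mxtrace /weight.
under eq_bigr do rewrite mxE.
rewrite exchange_big /=; apply: eq_bigr => l _.
rewrite /dotv mulr_sumr; apply: eq_bigr => j _.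
by rewrite mul_mx_diag !mxE [W l j * _]mulrC mulrA.
Qed.

Lemma weight_le_nuclear : weight <= nuclear_norm (W^T *m diag_mx v *m W).
Proof.
rewrite -trace_weight; apply: trace_le_nuclear_norm.
rewrite !trmx_mul trmxK tr_diag_mx. by rewrite mulmxA.
Qed.

End QuadraticForm.

(** The rank is at most d < k, so the left kernel contains a nonzero row. *)
Lemma left_kernel_exists {R : realType} {k d : nat} (W : 'M[R]_(k, d)) : (d < k)%N ->
  exists2 a : 'cV[R]_k, 0 < dotv a a & W^T *m a = 0.
Proof.
move=> dk.
have kz : kermx W != 0.
  rewrite -mxrank_eq0 mxrank_ker subn_eq0 -ltnNge.
  by apply: leq_ltn_trans dk; exact: rank_leq_col.
have /rowV0Pn[r rk r0] := kz.
exists r^T.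
  rewrite lt_neqAle dotv_ge0 andbT eq_sym; apply: contra r0 => /eqP h.
  apply/eqP/rowP => j; rewrite mxE.
  have sq i : 0 <= r^T i 0 * r^T i 0 by rewrite -expr2 sqr_ge0.
  have := psumr_eq0P (fun i _ => sq i) h => /(_ j isT) /eqP.
  by rewrite !mxE -expr2 sqrf_eq0 => /eqP.
by rewrite -trmx_mul (sub_kermxP rk) trmx0.
Qed.

Section CriticalPoints.
Context {R : realType} {n k d : nat} (xs : 'I_n -> 'cV[R]_d).
Variables (Wstar : 'M[R]_(k, d)) (vstar : 'rV[R]_k) (nu : R).
Let ys i := net vstar Wstar (xs i).
Let L := emp_loss xs ys (const_mx nu : 'rV[R]_k).
Let tau := weight vstar Wstar.
Hypothesis n0 : (0 < n)%N.
Hypothesis nu0 : 0 < nu.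
Hypothesis vstar0 : forall l, 0 <= vstar 0 l.
Hypothesis lower : forall u, n%:R / 8 * dotv u u <= \sum_i dotv u (xs i) ^+ 2.
Hypothesis upper : \sum_i ys i ^+ 2 <= 588 * n%:R * tau ^+ 2.
Variables (W : 'M[R]_(k, d)) (eg eH : R).
Let q i := net (const_mx nu : 'rV[R]_k) W (xs i).
Let rho i := ys i - q i.
Let t := Num.sqrt nu * frob W.
Hypothesis hg : frob (grad L W) <= eg.

Let N0 : 0 < n%:R :> R. Proof. by rewrite ltr0n. Qed.

Let frobE : frob W ^+ 2 = \sum_l dotv (row l W)^T (row l W)^T.
Proof.
rewrite /frob sqr_sqrtr; last first.
  by apply: sumr_ge0 => i _; apply: sumr_ge0 => j _; exact: sqr_ge0.
by apply: eq_bigr => l _; apply: eq_bigr => j _; rewrite !mxE expr2.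
Qed.

Let t2 : t ^+ 2 = nu * frob W ^+ 2.
Proof. by rewrite exprMn sqr_sqrtr ?ltW. Qed.

(** The gradient is paired with [W] itself, which gives -(2 / n) times the sum of rho_i q_i;
    Cauchy-Schwarz bounds the pairing. *)
Let residual_gradient : - \sum_i rho i * q i <= n%:R / 2 * (eg * frob W).
Proof.
have := grad_emp_loss xs ys nu W (mxvec W); rewrite -/L mxvecK => gE.
have h : \sum_p mxvec W 0 p * grad L W 0 p <= eg * frob W.
  have CS := sum_CauchySchwarz (fun p => mxvec W 0 p) (fun p => grad L W 0 p).
  have e1 : \sum_p mxvec W 0 p ^+ 2 = frob W ^+ 2.
    rewrite /frob sqr_sqrtr; last first.
      by apply: sumr_ge0 => i _; apply: sumr_ge0 => j _; exact: sqr_ge0.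
    rewrite pair_bigA /= (reindex _ (curry_mxvec_bij k d)) /=.
    by apply: eq_bigr => -[i j] _ /=; rewrite mxvecE.
  have e2 : \sum_p grad L W 0 p ^+ 2 = frob (grad L W) ^+ 2.
    rewrite /frob sqr_sqrtr; last first.
      by apply: sumr_ge0 => i _; apply: sumr_ge0 => j _; exact: sqr_ge0.
    by rewrite big_ord1.
  rewrite e1 e2 -exprMn in CS.
  have f0 (p r : nat) (A : 'M[R]_(p, r)) : 0 <= frob A by exact: sqrtr_ge0.
  have := f0 _ _ W; have := f0 _ _ (grad L W) => g0 w0.
  apply: (@le_trans _ _ (frob W * frob (grad L W))).
    rewrite -[X in X <= _]mul1r; apply: le_trans (ler_norm _) _.
    by rewrite mul1r -(ger0_norm (mulr_ge0 w0 g0)) -ler_sqr ?nnegrE// !real_normK ?num_real.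
  by rewrite mulrC ler_wpM2r.
rewrite gE in h.
have e : \sum_i - (4 * nu * rho i * dotv (W *m xs i) (W *m xs i)) = 4 * - \sum_i rho i * q i.
  rewrite -sumrN mulr_sumr; apply: eq_bigr => i _.
  by rewrite /q net_const; ring.
rewrite -/(rho _) e -mulr_natr in h.
move: (- \sum_i rho i * q i) h => G h.
have hG : 2 * G <= n%:R * (eg * frob W).
  rewrite -(ler_pdivrMl _ _ N0); apply: le_trans h; rewrite le_eqVlt.
  by apply/orP; left; apply/eqP; field; rewrite gt_eqF.
lra.
Qed.

Lemma loss_le_grad_frob : (d < k)%N -> 0 <= eH -> psd_ge (hess L W) (- eH%:M) ->
  L W <= eg * frob W / 4 + eH * tau / (4 * nu).
Proof.
move=> dk eH0 hH.
have [a a0 aW] := left_kernel_exists W dk.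
(* In direction a b^T both sides carry the factor |a|^2, which is positive and cancels. *)
have quad b : - (eH * dotv b b) <= - (2 * nu / n%:R) * \sum_i rho i * dotv b (xs i) ^+ 2.
  have := hH (mxvec (a *m b^T)).
  rewrite opprK mulmxDr mulmxDl [X in _ <= X]mxE hess_emp_loss mxvecK.
  have Ux i : a *m b^T *m xs i = dotv b (xs i) *: a.
    apply/colP => l; rewrite -mulmxA !mxE big_ord1 mulrC mxE; congr (_ * _).
    by apply: eq_bigr => j _; rewrite mxE.
  have WU i : dotv (W *m xs i) (dotv b (xs i) *: a) = 0.
    rewrite (_ : dotv _ _ = ((W *m xs i)^T *m (dotv b (xs i) *: a)) 0 0); last first.
      by rewrite [RHS]mxE; apply: eq_bigr => j _; rewrite [_^T _ _]mxE.
    by rewrite -scalemxAr trmx_mul -mulmxA aW mulmx0 scaler0 mxE.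
  have UU i : dotv (dotv b (xs i) *: a) (dotv b (xs i) *: a) = dotv b (xs i) ^+ 2 * dotv a a.
    by rewrite /dotv mulr_sumr; apply: eq_bigr => j _; rewrite !mxE; ring.
  under eq_bigr do rewrite Ux WU UU expr0n /= mulr0 sub0r.
  have -> : (mxvec (a *m b^T) *m eH%:M *m (mxvec (a *m b^T))^T) 0 0 = eH * (dotv a a * dotv b b).
    rewrite mul_mx_scalar -scalemxAl mxE; congr (_ * _).
    rewrite mxE (reindex _ (curry_mxvec_bij k d)) /=.
    rewrite /dotv mulr_suml; under [RHS]eq_bigr do rewrite mulr_sumr.
    rewrite pair_bigA /=; apply: eq_bigr => -[i j] _ /=.
    by rewrite mxE mxvecE mxE big_ord1 !mxE; ring.
  have -> : \sum_i - (4 * nu * (ys i - net (const_mx nu) W (xs i)) *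
        (dotv b (xs i) ^+ 2 * dotv a a)) =
      - (4 * nu * dotv a a) * \sum_i rho i * dotv b (xs i) ^+ 2.
    by rewrite mulr_sumr; apply: eq_bigr => i _; rewrite /rho /q; ring.
  move: (\sum_i _) => G h.
  rewrite -(ler_pM2l a0) -subr_ge0; apply: le_trans h _.
  by rewrite le_eqVlt; apply/orP; left; apply/eqP; rewrite -mulr_natr; field; rewrite gt_eqF.
(* [quad] at the rows of [Wstar], weighted by the nonnegative entries of [vstar]: the squares add up
   to y_i and the norms to [tau]. *)
have rq : \sum_i rho i * ys i <= n%:R * (eH * tau) / (2 * nu).
  have : - (eH * tau) <= - (2 * nu / n%:R) * \sum_i rho i * ys i.
    rewrite /tau /weight.
    have -> : \sum_i rho i * ys i =
        \sum_l vstar 0 l * \sum_i rho i * dotv (row l Wstar)^T (xs i) ^+ 2.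
      under [RHS]eq_bigr do rewrite mulr_sumr.
      rewrite exchange_big /=; apply: eq_bigr => i _.
      by rewrite /ys net_dotv mulr_sumr; apply: eq_bigr => l _; ring.
    rewrite !mulr_sumr -sumrN; apply: ler_sum => l _.
    have := ler_wpM2l (vstar0 l) (quad (row l Wstar)^T).
    by move=> h; apply: le_trans (le_trans h _); rewrite le_eqVlt; apply/orP; left; apply/eqP; ring.
  move: (\sum_i _) => G; rewrite mulNr lerN2 => h.
  have nu2 : 0 < 2 * nu by rewrite mulr_gt0.
  rewrite ler_pdivlMr//.
  have -> : G * (2 * nu) = n%:R * (2 * nu / n%:R * G) by field; rewrite gt_eqF.
  by rewrite ler_pM2l.
(* By rho^2 = rho y - rho q the loss splits into two sums with separate bounds. *)
have LE : L W = (n%:R * 2)^-1 * (\sum_i rho i * ys i - \sum_i rho i * q i).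
  rewrite /L /emp_loss mulr_natr; congr (_ * _); rewrite -sumrB.
  by apply: eq_bigr => i _; rewrite -/(q i) -/(rho i) -mulrBr expr2.
rewrite LE ler_pdivrMl; last by have := N0; lra.
have := residual_gradient.
move: (\sum_i rho i * ys i) (\sum_i rho i * q i) rq => A B rq h.
apply: le_trans (lerD rq h) _.
by rewrite le_eqVlt; apply/orP; left; apply/eqP; field; rewrite gt_eqF.
Qed.

(** Row by row, [lower] gives sum q_i >= n t^2 / 8, hence sum q_i^2 >= n t^4 / 64 by Cauchy-Schwarz;
    moreover -rho q = q^2 - y q >= (q^2 - y^2) / 2. *)
Lemma grad_lower_bound : t ^+ 4 / 64 - 588 * tau ^+ 2 <= eg * frob W.
Proof.
have sq : n%:R / 8 * t ^+ 2 <= \sum_i q i.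
  rewrite t2 frobE.
  have -> : \sum_i q i = \sum_l nu * \sum_i dotv (row l W)^T (xs i) ^+ 2.
    under [RHS]eq_bigr do rewrite mulr_sumr.
    rewrite exchange_big /=; apply: eq_bigr => i _.
    by rewrite /q net_dotv; apply: eq_bigr => l _; rewrite mxE.
  rewrite mulrCA mulr_sumr mulr_sumr; apply: ler_sum => l _.
  by rewrite ler_pM2l.
have sq2 : n%:R * (t ^+ 4 / 64) <= \sum_i q i ^+ 2.
  have := sum_CauchySchwarz q (fun=> 1).
  under eq_bigr do rewrite mulr1.
  under [X in _ <= _ * X]eq_bigr do rewrite expr1n.
  rewrite sumr_const card_ord => CS.
  rewrite -(ler_pM2r N0); apply: le_trans CS.
  apply: (@le_trans _ _ ((n%:R / 8 * t ^+ 2) ^+ 2)).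
    by rewrite le_eqVlt; apply/orP; left; apply/eqP; field.
  have p0 : 0 <= n%:R / 8 * t ^+ 2 by rewrite mulr_ge0 ?sqr_ge0// divr_ge0.
  by rewrite ler_sqr ?nnegrE// (le_trans p0 sq).
have h2 : (\sum_i q i ^+ 2 - \sum_i ys i ^+ 2) / 2 <= - \sum_i rho i * q i.
  rewrite -sumrB -sumrN mulr_suml; apply: ler_sum => i _.
  rewrite /rho; have := sqr_ge0 (ys i - q i); nra.
rewrite -(ler_pM2l N0); have := residual_gradient.
move: upper sq2 h2.
move: (\sum_i ys i ^+ 2) (\sum_i q i ^+ 2) (\sum_i rho i * q i) => A B G; lra.
Qed.

(** With g = eg / sqrt(nu) and t = sqrt(nu) |W|_F the gradient term is g t / 4, so it suffices that
    t is at most four times the maximum. *)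
Lemma critical_loss_bound (N : R) : (d < k)%N -> 0 <= eg -> 0 <= eH ->
  tau <= N -> psd_ge (hess L W) (- eH%:M) ->
  L W <= eg / Num.sqrt nu *
           Num.max (Num.sqrt (1 + 14%:R * N)) (4%:R * (eg / Num.sqrt nu))
         + eH / (2%:R * nu) * N.
Proof.
move=> dk eg0 eH0 tN hH.
apply: le_trans (loss_le_grad_frob dk eH0 hH) _.
have tau0 : 0 <= tau by apply: sumr_ge0 => l _; rewrite mulr_ge0// dotv_ge0.
have s0 : 0 < Num.sqrt nu by rewrite sqrtr_gt0.
have F0 : 0 <= frob W by exact: sqrtr_ge0.
have t0 : 0 <= t by rewrite mulr_ge0// ltW.
pose g := eg / Num.sqrt nu.
have g0 : 0 <= g by rewrite divr_ge0// ltW.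
have gt : eg * frob W = g * t by rewrite /g /t; field; rewrite gt_eqF.
apply: lerD; last first.
  apply: (@le_trans _ _ (eH / (2 * nu) * tau)).
    have X0 : 0 <= eH / (2 * nu) * tau.
      by rewrite mulr_ge0// divr_ge0// mulr_ge0// ltW.
    have -> : eH * tau / (4 * nu) = eH / (2 * nu) * tau / 2.
      by field; rewrite gt_eqF.
    by move: X0; lra.
  by rewrite ler_wpM2l// divr_ge0// mulr_ge0// ltW.
rewrite gt -mulrA; apply: ler_wpM2l => //; rewrite -/g.
rewrite ler_pdivrMr//; set m := Num.max _ _.
have m1 : Num.sqrt (1 + 14 * N) <= m by rewrite le_max lexx.
have m2 : 4 * g <= m by rewrite le_max lexx orbT.
have N0' : 0 <= 1 + 14 * N by lra.
have m3 : 1 + 14 * N <= m ^+ 2.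
  by rewrite -(sqr_sqrtr N0') ler_sqr ?nnegrE ?sqrtr_ge0// (le_trans _ m1)// sqrtr_ge0.
rewrite leNgt; apply/negP => tm.
have m0 : 0 <= m by apply: le_trans m1; exact: sqrtr_ge0.
have tt : 16 * m ^+ 2 < t ^+ 2 by nra.
have := grad_lower_bound; rewrite gt.
have t4 : t ^+ 4 = t ^+ 2 * t ^+ 2 by ring.
have gtt : g * t <= t ^+ 2 / 16 by nra.
rewrite t4; move: (t ^+ 2) tt gtt => T tt gtt.
(* T = t^2 exceeds 16 (1 + 14 tau), so 588 tau^2 <= 588 T^2 / 224^2 = 3 T^2 / 256. The gradient
   bound then leaves T^2 / 256 <= T / 16, against T > 16. *)
have T16 : 16 < T by lra.
have Ttau : 224 * tau < T by lra.
nra.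
Qed.

End CriticalPoints.

(** * The good event *)

Section Events.
Context {dT : measure_display} {T : measurableType dT} {R : realType}
  (P : probability T R).
Local Notation Ex f := (\int[P]_w (f w)%:E)%E.
Variables (n d : nat) (X : 'I_n * 'I_d -> T -> R).
Hypothesis mX : forall ij, measurable_fun [set: T] (X ij).
Hypothesis indX : mutually_independent P X.
Hypothesis mgfX : forall ij s, Ex (fun w => expR (s * X ij w)) = (expR (s ^+ 2 / 2))%:E.
Hypothesis d8 : (8 <= d)%N.
Hypothesis nlarge : 5 * 6144 * (d%:R * ln d%:R) <= n%:R :> R.
Let x := sample X.
Let D := (8 * d ^ 2)%N.

Let d8R : 8 <= d%:R :> R. Proof. by rewrite ler_nat. Qed.
Let d0 : 0 < d%:R :> R. Proof. by apply: lt_le_trans d8R. Qed.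

Let lnd : 2^-1 <= ln d%:R :> R.
Proof.
rewrite -[leLHS]expRK ler_ln ?posrE ?expR_gt0//.
by apply: le_trans expR_half_le2 _; have := d8R; lra.
Qed.

Let nd : d%:R <= n%:R :> R.
Proof.
apply: le_trans nlarge; rewrite mulrCA -[leLHS]mulr1 ler_pM2l//.
by have := lnd; lra.
Qed.

Definition grid_bad : set T := \bigcup_(m in [set: {ffun 'I_d -> 'I_(2 * D).+1}])
  [set w | (\sum_i dotv (grid D m) (x w i) ^+ 2 <
            n%:R / 2 * dotv (grid D m) (grid D m))%R].

Let mdot2 (u : 'cV[R]_d) : measurable_fun [set: T] (fun w => \sum_i dotv u (x w i) ^+ 2).
Proof. by apply: measurable_sum => i; apply: measurable_funX; exact: measurable_dot. Qed.

Lemma measurable_lt_set (f g : T -> R) : measurable_fun [set: T] f ->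
  measurable_fun [set: T] g -> measurable [set w | (f w < g w)%R].
Proof.
move=> mf mg; rewrite (_ : [set w | _] = ~` [set w | (g w <= f w)%R]).
  by apply: measurableC; rewrite -[X in measurable X]setTI; exact: measurable_fun_le.
by apply/seteqP; split => w /=; rewrite ltNge => /negP.
Qed.

Lemma measurable_grid_bad : measurable grid_bad.
Proof. by apply: fin_bigcup_measurable => // m _; apply: measurable_lt_set. Qed.

Let direction_tail (g : 'cV[R]_d) :
  (P [set w | (\sum_i dotv g (x w i) ^+ 2 < n%:R / 2 * dotv g g)%R] <=
   (expR (- (n%:R / 6144)))%:E)%E.
Proof.
(* At a vanishing grid point the event is empty because its inequality is strict. *)
have [g0|g0] := eqVneq (dotv g g) 0.
  rewrite (_ : [set w | _] = set0) ?measure0 ?lee_fin ?expR_ge0//.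
  apply/seteqP; split => w //=; rewrite g0 mulr0 ltNge.
  by rewrite (sumr_ge0 _ (fun i _ => sqr_ge0 _)).
have gp : 0 < dotv g g by rewrite lt_neqAle eq_sym g0 dotv_ge0.
pose a := (Num.sqrt (dotv g g))^-1.
have a2 : a ^+ 2 = (dotv g g)^-1 by rewrite /a exprVn sqr_sqrtr// ltW.
have u1 : dotv (a *: g) (a *: g) = 1.
  by rewrite dotvZl dotvC dotvZl mulrA -expr2 a2 mulVf.
apply: le_trans (sqr_dot_sum_lower_tail mX indX mgfX u1).
apply: le_measure; rewrite ?inE.
- exact: measurable_lt_set.
- by rewrite -[X in measurable X]setTI; apply: measurable_fun_le.
- move=> w /= h; under eq_bigr do rewrite dotvZl exprMn a2.
  by rewrite -mulr_sumr ler_pdivrMl// mulrC ltW.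
Qed.

(** The grid has (16 d^2 + 1)^d <= exp(4 d ln d) points, and each fails with probability at most
    exp(-n / 6144) <= exp(-5 d ln d); what remains is exp(-d ln d) <= 1 / d. *)
Lemma grid_bad_le : (P grid_bad <= (d%:R^-1)%:E)%E.
Proof.
apply: le_trans (union_bound _ (fun m => direction_tail (grid D m))) _.
  by move=> m; exact: measurable_lt_set.
rewrite lee_fin card_ffun !card_ord.
have card : ((2 * D).+1 ^ d)%N%:R <= expR (4 * d%:R * ln d%:R) :> R.
  have -> : expR (4 * d%:R * ln d%:R) = (d%:R ^+ 4) ^+ d :> R.
    rewrite -exprM -[in RHS](lnK (x := d%:R)) ?posrE// -expRM_natl natrM.
    by congr expR.
  rewrite natrX; apply: lerXn2r; rewrite ?nnegrE// ?exprn_ge0//.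
  have -> : (2 * D).+1%:R = 16 * d%:R ^+ 2 + 1 :> R.
    by rewrite -natr1 /D -mulnn !natrM; ring.
  have h2 : 64 <= d%:R ^+ 2 :> R by rewrite expr2; have := d8R; nra.
  rewrite (_ : d%:R ^+ 4 = d%:R ^+ 2 * d%:R ^+ 2 :> R); last by ring.
  by move: (d%:R ^+ 2) h2 => y; nra.
apply: (@le_trans _ _ (expR (4 * d%:R * ln d%:R) * expR (- (n%:R / 6144)))).
  by apply: ler_wpM2r; [exact: expR_ge0|exact: card].
rewrite -expRD -[leRHS]lnK ?posrE ?invr_gt0// lnV ?posrE// ler_expR.
have : ln d%:R <= d%:R * ln d%:R :> R.
  by rewrite -[leLHS]mul1r; apply: ler_wpM2r; [have := lnd; lra|have := d8R; lra].
have := nlarge; rewrite -[4 * d%:R * _]mulrA; lra.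
Qed.

Definition norm_bad : set T :=
  [set w | (8 * n%:R * d%:R ^+ 2 <= \sum_ij X ij w ^+ 2)%R].

Let mS : measurable_fun [set: T] (fun w => \sum_ij X ij w ^+ 2).
Proof. by apply: measurable_sum => ij; exact: measurable_funX. Qed.

Lemma measurable_norm_bad : measurable norm_bad.
Proof. by rewrite -[norm_bad]setTI; apply: measurable_fun_le. Qed.

(** Markov's inequality: each entry has second moment at most 2! 4 = 8, so the mean is at most 8 n
    d, a factor d below the threshold. *)
Lemma norm_bad_le : (P norm_bad <= (d%:R^-1)%:E)%E.
Proof.
have n0 : 0 < n%:R :> R by apply: lt_le_trans nd.
have p0 : 0 < 8 * n%:R * d%:R ^+ 2 :> R by rewrite mulr_gt0 ?exprn_gt0// mulr_gt0.
apply: le_trans (ge0_markov P mS _ p0) _.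
  by move=> w; apply: sumr_ge0 => ij _; exact: sqr_ge0.
have E2 ij : (Ex (fun w => (X ij w ^+ 2)%R) <= 8%:E)%E.
  have mg s : Ex (fun w => expR (s * X ij w)) = (expR (s ^+ 2 * 1 / 2))%:E.
    by rewrite mgfX mulr1.
  have := mgf_moment_le (mX ij) mg 2 (lexx _).
  under eq_integral do rewrite real_normK ?num_real//.
  by move/le_trans; apply; rewrite lee_fin (_ : 2`! = 2)%N//; lra.
apply: (@le_trans _ _ (((8 * n%:R * d%:R ^+ 2)^-1)%:E * (8 * (n%:R * d%:R))%:E)%E).
  apply: lee_wpmul2l; first by rewrite lee_fin invr_ge0 ltW.
  rewrite ge0_Rint_sum; last 2 first.
  - by move=> ij; exact: measurable_funX.
  - by move=> ij w; exact: sqr_ge0.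
  have -> : 8 * (n%:R * d%:R) = \sum_(ij : 'I_n * 'I_d) 8 :> R.
    by rewrite sumr_const card_prod !card_ord -natrM mulr_natr.
  by rewrite -sumEFin; apply: lee_sum => ij _.
rewrite -EFinM lee_fin le_eqVlt; apply/orP; left; apply/eqP; field.
by rewrite !gt_eqF.
Qed.

Lemma good_lower_bound w : ~ grid_bad w -> ~ norm_bad w ->
  forall u, n%:R / 8 * dotv u u <= \sum_i dotv u (x w i) ^+ 2.
Proof.
move=> gw nw; apply: grid_lower_bound => //.
  move=> m; rewrite leNgt; apply/negP => h; apply: gw.
  by exists m.
rewrite leNgt; apply/negP => h; apply: nw; rewrite /norm_bad /=.
apply: (le_trans (ltW h)); rewrite le_eqVlt; apply/orP; left; apply/eqP.
transitivity (\sum_i \sum_j X (i, j) w ^+ 2); last first.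
  by rewrite pair_bigA; apply: eq_bigr => -[].
by apply: eq_bigr => i _; apply: eq_bigr => j _; rewrite mxE expr2.
Qed.

Variables (k : nat) (v : 'rV[R]_k) (W : 'M[R]_(k, d)).
Hypothesis v0 : forall l, 0 <= v 0 l.
Let tau := weight v W.
Let Y i w := net v W (x w i) ^+ 2.

Definition label_bad : set T := [set w | (588 * n%:R * tau ^+ 2 < \sum_i Y i w)%R].

Let mY_row i : measurable_fun setT
  ((fun w => Y i w) : g_sigma_algebraType (row_cylinders X i) -> R).
Proof.
apply: measurable_funX; under eq_fun do rewrite net_dotv.
apply: measurable_sum => l; apply: measurable_funM => //.
by apply: measurable_funX; exact: measurable_row_dot.
Qed.

Let mY i : measurable_fun [set: T] (Y i).
Proof.
apply: measurable_funX; under eq_fun do rewrite net_dotv.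
apply: measurable_sum => l; apply: measurable_funM => //.
by apply: measurable_funX; exact: measurable_dot.
Qed.

Lemma measurable_label_bad : measurable label_bad.
Proof. by apply: measurable_lt_set => //; exact: measurable_sum. Qed.

(* Normalizing the rows of W makes y a combination of squares of standard
   Gaussians, so that Jensen's inequality bounds its moments. *)
Let normalized : exists p : 'I_k -> R, exists u : 'I_k -> 'cV[R]_d,
  [/\ forall l, 0 <= p l, forall l, dotv (u l) (u l) <= 1, \sum_l p l = tau &
      forall z, net v W z = \sum_l p l * dotv (u l) z ^+ 2].
Proof.
pose r l := Num.sqrt (dotv (row l W)^T (row l W)^T).
have r2 l : r l ^+ 2 = dotv (row l W)^T (row l W)^T by rewrite sqr_sqrtr// dotv_ge0.
have H l : exists u : 'cV[R]_d, dotv u u <= 1 /\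
    forall z, dotv (row l W)^T z = r l * dotv u z.
  have [r0|r0] := eqVneq (r l) 0.
    exists 0; split=> [|z].
      by rewrite /dotv big1// => j _; rewrite mxE mul0r.
    rewrite r0 mul0r; apply/eqP; rewrite -sqrf_eq0 eq_le sqr_ge0 andbT.
    by apply: le_trans (dotv_CauchySchwarz _ _) _; rewrite -r2 r0 expr0n mul0r.
  exists ((r l)^-1 *: (row l W)^T); split=> [|z]; last by rewrite dotvZl mulVKf.
  by rewrite dotvZl dotvC dotvZl -r2 expr2 mulKf// mulVf.
have [u hu] := choice H.
exists (fun l => v 0 l * r l ^+ 2), u; split=> [l|l||z].
- by rewrite mulr_ge0// sqr_ge0.
- exact: (hu l).1.
- by apply: eq_bigr => l _; rewrite r2.
- by rewrite net_dotv; apply: eq_bigr => l _; rewrite (hu l).2 exprMn mulrA.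
Qed.

(** [Y i] is the squared label y^2. Jensen gives y^2 <= tau sum p_l z_l^4 and y^4 <= tau^3 sum p_l
    z_l^8, with moments at most 4! 4 = 96 and 8! 4 = 96 * 1680. *)
Let moments i : (Ex (Y i) <= (96 * tau ^+ 2)%:E)%E /\
  (Ex (fun w => Y i w ^+ 2) <= ((96 * 1680) * tau ^+ 4)%:E)%E.
Proof.
have [p [u [p0 u1 pt netE]]] := normalized.
have tau0 : 0 <= tau by rewrite -pt; exact: sumr_ge0.
pose z l w := dotv (u l) (x w i).
have mz l : measurable_fun [set: T] (z l) by exact: measurable_dot.
have zmom l m : (Ex (fun w => z l w ^+ (2 * m)) <= ((2 * m)`!%:R * 4)%:E)%E.
  have := mgf_moment_le (mz l) (mgf_dot_sample mX indX mgfX (u l) i) (2 * m) (u1 l).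
  by under eq_integral do rewrite exprM real_normK ?num_real// -exprM.
have J2 w : Y i w <= tau * \sum_l p l * z l w ^+ (2 * 2).
  have -> : \sum_l p l * z l w ^+ (2 * 2) = \sum_l p l * (z l w ^+ 2) ^+ 2.
    by apply: eq_bigr => l _; rewrite exprM.
  by rewrite /Y netE -pt; exact: sum_jensen_sqr.
have s0 m w : 0 <= \sum_l p l * z l w ^+ (2 * m).
  by apply: sumr_ge0 => l _; rewrite mulr_ge0// exprM exprn_ge0// sqr_ge0.
have J4 w : Y i w ^+ 2 <= tau ^+ 3 * \sum_l p l * z l w ^+ (2 * 4).
  apply: (@le_trans _ _ ((tau * \sum_l p l * z l w ^+ (2 * 2)) ^+ 2)).
    have y0 : 0 <= Y i w by exact: sqr_ge0.
    by apply: lerXn2r (J2 w); rewrite nnegrE// (le_trans y0).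
  have -> : \sum_l p l * z l w ^+ (2 * 4) = \sum_l p l * (z l w ^+ (2 * 2)) ^+ 2.
    by apply: eq_bigr => l _; rewrite -exprM.
  rewrite exprMn [tau ^+ 3]exprSr -mulrA; apply: ler_wpM2l; first exact: sqr_ge0.
  by rewrite -{1}pt; exact: sum_jensen_sqr.
have Esum m : (Ex (fun w => \sum_l p l * z l w ^+ (2 * m)) <= (tau * ((2 * m)`!%:R * 4))%:E)%E.
  have mzm l : measurable_fun [set: T] (fun w => z l w ^+ (2 * m)) by exact: measurable_funX.
  have zm0 l w : 0 <= z l w ^+ (2 * m) by rewrite exprM exprn_ge0// sqr_ge0.
  rewrite ge0_Rint_sum; last 2 first.
  - by move=> l; exact: measurable_funM.
  - by move=> l w; exact: mulr_ge0.
  rewrite -pt mulr_suml -sumEFin; apply: lee_sum => l _.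
  rewrite ge0_RintZ// EFinM; apply: lee_wpmul2l; first by rewrite lee_fin.
  exact: zmom.
have msum m : measurable_fun [set: T] (fun w => \sum_l p l * z l w ^+ (2 * m)).
  by apply: measurable_sum => l; apply: measurable_funM => //; exact: measurable_funX.
split.
  apply: (@le_trans _ _ (Ex (fun w => tau * \sum_l p l * z l w ^+ (2 * 2)))).
    by apply: ge0_Rint_le => //; [exact: measurable_funM|move=> w; exact: sqr_ge0].
  rewrite ge0_RintZ//; apply: (@le_trans _ _ (tau%:E * (tau * ((2 * 2)`!%:R * 4))%:E)%E).
    by apply: lee_wpmul2l; [rewrite lee_fin|exact: Esum].
  by rewrite -EFinM lee_fin (_ : (2 * 2)`! = 24)%N// expr2; lra.
apply: (@le_trans _ _ (Ex (fun w => tau ^+ 3 * \sum_l p l * z l w ^+ (2 * 4)))).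
  apply: ge0_Rint_le => //; [exact: measurable_funX|exact: measurable_funM|].
  by move=> w; exact: sqr_ge0.
rewrite ge0_RintZ ?exprn_ge0//.
apply: (@le_trans _ _ ((tau ^+ 3)%:E * (tau * ((2 * 4)`!%:R * 4))%:E)%E).
  by apply: lee_wpmul2l; [rewrite lee_fin exprn_ge0|exact: Esum].
have f8 : (2 * 4)`!%:R * 4 <= 96 * 1680 :> R.
  by rewrite (_ : (2 * 4)%N = 8%N)// !factS fact0 !natrM; lra.
rewrite -EFinM lee_fin; move: (_`!%:R * 4) f8 => F f8.
have -> : tau ^+ 3 * (tau * F) = F * tau ^+ 4 by ring.
by apply: ler_wpM2r => //; exact: exprn_ge0.
Qed.

Lemma label_bad_le : (P label_bad <= (d%:R^-1)%:E)%E.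
Proof.
have [p [u [p0 u1 pt netE]]] := normalized.
have tau0 : 0 <= tau by rewrite -pt; exact: sumr_ge0.
have n0 : 0 < n%:R :> R by apply: lt_le_trans nd.
(* For [tau] = 0 all labels vanish and the strict inequality makes the event empty. *)
have [t0|t0] := eqVneq tau 0.
  rewrite (_ : label_bad = set0) ?measure0 ?lee_fin ?invr_ge0//.
  apply/seteqP; split => w //=; rewrite /label_bad /= t0 expr0n mulr0 ltNge big1 ?lexx// => i _.
  rewrite /Y netE big1 ?expr0n// => l _.
  have /eqP := pt; rewrite t0 psumr_eq0// => /allP /(_ l (mem_index_enum _)) /eqP ->.
  by rewrite mul0r.
have tp : 0 < tau by rewrite lt_neqAle eq_sym t0.
(* 492 = 588 - 96 is the margin above the mean; 492^2 >= 96 * 1680 makes Chebyshev's bound at most 1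
   / n <= 1 / d. *)
have lam0 : 0 < 492 * n%:R * tau ^+ 2.
  by apply: mulr_gt0; [apply: mulr_gt0; [rewrite ltr0n|exact: n0]|exact: exprn_gt0].
have := indep_sum_upper_tail mY (row_functions_indep mX indX mY_row)
  (fun i w => sqr_ge0 _) (fun i => (moments i).1) (fun i => (moments i).2) lam0.
rewrite card_ord => h; apply: le_trans (le_trans h _).
  apply: le_measure; rewrite ?inE; first exact: measurable_label_bad.
    rewrite -[X in measurable X]setTI; apply: measurable_fun_le => //.
    exact: measurable_sum.
  by move=> w; rewrite /label_bad /= => /ltW; apply: le_trans; lra.
rewrite lee_fin.
apply: (@le_trans _ _ n%:R^-1); last by rewrite lef_pV2 ?posrE.
rewrite ler_pdivrMl ?exprn_gt0//.
have -> : (492 * n%:R * tau ^+ 2) ^+ 2 / n%:R = n%:R * (492 * 492 * tau ^+ 4).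
  by field; rewrite gt_eqF.
rewrite ler_pM2l// ler_wpM2r ?exprn_ge0//; lra.
Qed.

End Events.

(** * Assembly of the probability and loss bounds *)

(** The list of singular values is empty and the default of [head] is returned; positivity of
    [sigma_min] thus excludes d = 0. *)
Lemma sigma_min_no_columns {R : realType} {p : nat} (M : 'M[R]_(p, 0)) :
  sigma_min M = 0.
Proof.
rewrite /sigma_min /sing_vals /eigvals; case: pselect => // h.
case: (cid h) => s /= hs; have := size_char_poly (M^T *m M).
by rewrite hs size_prod_XsubC => -[/size0nil ->].
Qed.

Theorem theorem2p2 (R : realType) :
  exists c C gamma : R, 0 < c /\ 0 < C /\ 0 < gamma /\
  forall (k d n : nat) (Wstar : 'M[R]_(k, d)) (vstar : 'rV[R]_k) (nu : R)
    (dT : measure_display) (T : measurableType dT) (P : probability T R)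
    (X : 'I_n * 'I_d -> {RV P >-> R}),
    (d < k)%N ->
    0 < sigma_min Wstar ->
    (forall l, 0 <= vstar 0 l) ->
    0 < nu ->
    mutually_independent P (fun ij => (X ij : T -> R)) ->
    (forall ij, distribution P (X ij) = normal_prob 0 1) ->
    c * d%:R * ln d%:R <= n%:R <= C * d%:R ^+ 2 ->
    let xs (w : T) (i : 'I_n) : 'cV[R]_d := \col_j X (i, j) w in
    let ys (w : T) (i : 'I_n) : R := net vstar Wstar (xs w i) in
    let v : 'rV[R]_k := const_mx nu in
    let L (w : T) (W : 'M[R]_(k, d)) : R := emp_loss (xs w) (ys w) v W in
    let N := nuclear_norm (Wstar^T *m diag_mx vstar *m Wstar) in
    exists A : set T, measurable A /\
      ((1 - 12%:R * d%:R * expR (- gamma * d%:R) - 8%:R / d%:R)%:E <= P A)%E /\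
      forall w, A w ->
        forall (eps_g eps_H : R) (W : 'M[R]_(k, d)),
          0 <= eps_g -> 0 <= eps_H ->
          frob (grad (L w) W) <= eps_g ->
          psd_ge (hess (L w) W) (- eps_H%:M) ->
          L w W <= eps_g / Num.sqrt nu *
                     Num.max (Num.sqrt (1 + 14%:R * N)) (4%:R * (eps_g / Num.sqrt nu))
                   + eps_H / (2%:R * nu) * N.
Proof.
(* Of the five multiples of 6144, four pay for the cardinality of the grid and one leaves the
   probability 1 / d. *)
exists (5 * 6144), 1, 1; split; first by apply: mulr_gt0; rewrite ltr0n.
do 2 split => //.
move=> k d n Wstar vstar nu dT T P X dk sW v0 nu0 indX distX /andP[cn _] xs ys v L N.
have dpos : (0 < d)%N.
  rewrite lt0n; apply/negP => /eqP d0; move: sW; clear -d0; subst d.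
  by rewrite sigma_min_no_columns ltxx.
have dR : 0 < d%:R :> R by rewrite ltr0n.
have E0 : 0 <= 12 * d%:R * expR (- 1 * d%:R) :> R.
  by rewrite mulr_ge0 ?expR_ge0// mulr_ge0// ltW.
(* For d < 8 the term 8 / d exceeds 1, the required probability is negative and the empty event
   serves. *)
have [d8|d8] := leqP 8 d; last first.
  exists set0; split; first exact: measurable0; split => //.
  rewrite measure0 lee_fin -addrA -opprD subr_le0.
  apply: ler_wpDl => //; rewrite ler_pdivlMr// mul1r ler_nat; exact: ltnW.
have mX ij : measurable_fun [set: T] (X ij : T -> R) by exact: measurable_funPT.
have mgfX ij s : (\int[P]_w (expR (s * X ij w))%:E = (expR (s ^+ 2 / 2))%:E)%E.
  rewrite -(normal_mgf s (distX ij)) ge0_integral_distribution//.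
  apply/measurable_EFinP; rewrite (_ : (fun x => _) = expR \o ( *%R s))//.
  by apply: measurableT_comp; [exact: measurable_expR|exact: mulrl_measurable].
have nlarge : 5 * 6144 * (d%:R * ln d%:R) <= n%:R :> R by rewrite mulrA.
pose Y ij : T -> R := X ij.
pose B := grid_bad Y `|` norm_bad Y `|` label_bad Y vstar Wstar.
have mg : measurable (grid_bad Y) by exact: measurable_grid_bad.
have mn : measurable (norm_bad Y) by exact: measurable_norm_bad.
have ml : measurable (label_bad Y vstar Wstar) by exact: measurable_label_bad.
have mgn : measurable (grid_bad Y `|` norm_bad Y) by exact: measurableU.
have mB : measurable B by exact: measurableU.
exists (~` B); split; first exact: measurableC.
split.
  (* Three bad events of probability at most 1 / d each, within the allowed 8 / d. *)
  have PB : (P B <= (3 / d%:R)%:E)%E.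
    apply: le_trans (measureU2 P mgn ml) _.
    have -> : 3 / d%:R = d%:R^-1 + d%:R^-1 + d%:R^-1 :> R by ring.
    rewrite !EFinD; apply: leeD; last by apply: label_bad_le.
    apply: le_trans (measureU2 P mg mn) _.
    by apply: leeD; [apply: grid_bad_le|apply: norm_bad_le].
  rewrite probability_setC// EFinD; apply: (@le_trans _ _ (1 - (3 / d%:R)%:E)%E).
    rewrite -EFinB lee_fin -addrA lerD2l -opprD lerN2.
    apply: ler_wpDl => //; rewrite ler_wpM2r ?invr_ge0 ?ltW//; lra.
  by rewrite leeB.
move=> w /not_orP[/not_orP[ngb nnb] nlb] eg eH W eg0 eH0 hg hH.
have nR : 0 < n%:R :> R.
  apply: lt_le_trans nlarge; apply: mulr_gt0; first by apply: mulr_gt0; rewrite ltr0n.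
  by apply: mulr_gt0 => //; rewrite ln_gt0// ltr1n; apply: leq_trans d8.
apply: (@critical_loss_bound R n k d (xs w) Wstar vstar nu) => //.
- by rewrite -(ltr_nat R).
- exact: (good_lower_bound d8 ngb nnb).
- by rewrite leNgt; apply/negP => h; apply: nlb.
- exact: weight_le_nuclear.
Qed.
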